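(* Let $H_i,H:[0,T]\times\mathbb{R}^n\times\mathbb{R}^n\to\mathbb{R}$, $i\in\mathbb{N}$, be such that $H_i$ is boundedly admissible with data $(c_i,\lambda_i)$ for each $i$ and $H$ is boundedly admissible with data $(c,\lambda)$ (see context). Let $H_i,\lambda_i,c_i$ be continuous for every $i\in\mathbb{N}$. Let $B$ be the closed unit ball of $\mathbb{R}^{n+1}$ and let $(B,f_i,l_i)$ and $(B,f,l)$ be the canonical compact representations of $H_i$ and $H$, respectively, associated with these data (see context). If $H_i,\lambda_i,c_i$ converge to $H,\lambda,c$, respectively, uniformly on compact sets, then $f_i$ converge to $f$ and $l_i$ converge to $l$ uniformly on compact subsets of $[0,T]\times\mathbb{R}^n\times B$.
   Context: $|\cdot|$ is the Euclidean norm, $B(y,r)$ is the closed ball with center $y$ and radius $r\ge0$, $B_R$ is the closed ball in $\mathbb{R}^n$ centered at $0$ with radius $R$, $d(y,K):=\inf_{z\in K}|y-z|$, $\mathrm{dom}\,\varphi:=\{x:\varphi(x)\ne\pm\infty\}$. A null set is a set of Lebesgue measure zero. A modulus is a function $w:[0,T]\times[0,\infty)\to[0,\infty)$ such that $w(\cdot,r)$ is measurable for every $r\ge0$ and, for every $t$, $w(t,\cdot)$ is nondecreasing, continuous, subadditive and $w(t,0)=0$. For $H:[0,T]\times\mathbb{R}^n\times\mathbb{R}^n\to\mathbb{R}$ put $L(t,x,v):=\sup_{p\in\mathbb{R}^n}\{\langle v,p\rangle-H(t,x,p)\}$ and $E_L(t,x):=\{(v,\eta)\in\mathbb{R}^n\times\mathbb{R}: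 L(t,x,v)\le\eta\}$. We call $H$ boundedly admissible with data $(c,\lambda)$ if: $H(\cdot,x,p)$ is measurable for all $(x,p)$; $H(t,\cdot,\cdot)$ is continuous for every $t$; $H(t,x,\cdot)$ is convex for every $(t,x)$; $c:[0,T]\to[0,\infty)$ is measurable and $|H(t,x,p)-H(t,x,q)|\le c(t)(1+|x|)|p-q|$ for all $t,x,p,q$; for every $R>0$ there are a measurable $k_R:[0,T]\to[0,\infty)$, a modulus $w_R$ and a null set $\mathcal{N}_R$ such that $|H(t,x,p)-H(t,y,p)|\le k_R(t)|p||x-y|+w_R(t,|x-y|)$ for all $t\in[0,T]\setminus\mathcal{N}_R$, $x,y\in B_R$, $p\in\mathbb{R}^n$; and $\lambda:[0,T]\times\mathbb{R}^n\to\mathbb{R}$ is measurable in $t$ for all $x$, continuous in $x$ for all $t$, satisfies $L(t,x,v)\le\lambda(t,x)$ for all $t\in[0,T]$, $x\in\mathbb{R}^n$, $v\in\mathrm{dom}\,L(t,x,\cdot)$, and for every $R>0$ there are a modulus $\tilde w_R$ and a null set $\tilde{\mathcal{N}}_R$ with $|\lambda(t,x)-\lambda(t,y)|\le\tilde w_R(t,|x-y|)$ for $t\in[0,T]\setminus\tilde{\mathcal{N}}_R$, $x,y\in B_R$. (The quantities $k_R,w_R,\dots$ may be different for each $H_i$.) Steiner point: for a nonempty convex compact $K\subset\mathbb{R}^m$ let $\sigma(K,p):=\max_{x\in K}\langle p,x\rangle$, and let $m(\partial\sigma(K,p))$ be the element of minimal norm of the subdifferential of $\sigma(K,\cdot)$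 at $p$. Then $s_m(K):=\frac{1}{\mathrm{vol}(B)}\int_{B}m(\partial\sigma(K,p))\,dp\in K$, where $B$ is the closed unit ball of $\mathbb{R}^m$. Canonical compact representation: for $H$ boundedly admissible with data $(c,\lambda)$, put $M(t,x):=|\lambda(t,x)|+|H(t,x,0)|+c(t)(1+|x|)+1$ and, for $a$ in the closed unit ball $B$ of $\mathbb{R}^{n+1}$, $e(t,x,a):=s_{n+1}\big(E_L(t,x)\cap B(M(t,x)a,\,2d(M(t,x)a,E_L(t,x)))\big)\in\mathbb{R}^{n+1}$; define $f(t,x,a)\in\mathbb{R}^n$, $l(t,x,a)\in\mathbb{R}$ by $e(t,x,a)=(f(t,x,a),l(t,x,a))$. The triple $(B,f,l)$ is the canonical compact representation of $H$. *)

(* Defs.v *)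
From HB Require Import structures.
From mathcomp Require Import all_boot all_order all_algebra.
From mathcomp Require Import all_classical all_reals all_analysis.
From mathcomp Require Import measurable_realfun.

Set Implicit Arguments.
Unset Strict Implicit.
Unset Printing Implicit Defensive.
Import Order.TTheory GRing.Theory Num.Theory.
Import numFieldNormedType.Exports.
Local Open Scope classical_set_scope.
Local Open Scope ring_scope.

(** Euclidean geometry of R^m.  The library norm on row vectors is the max
    norm, hence the explicit Euclidean norm; only the topology and the
    uniformity of ['rV[R]_m], which do not depend on this choice, are taken from
    the library. *)

Section Euclidean.
Context {R : realType} {m : nat}.
Implicit Types (x y p xi : 'rV[R]_m) (K : set 'rV[R]_m).

Definition dot x y : R := \sum_i x 0 i * y 0 i.
Definition enorm x : R := Num.sqrt (dot x x).
Definition eball y (r : R) : set 'rV[R]_m := [set z | enorm (z - y) <= r].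
(* [inf] and [sup] are real-valued; below they are only taken of nonempty sets
   bounded on the relevant side (and [sup] over compact sets is a max). *)
Definition edist y K : R := inf [set enorm (y - z) | z in K].

Definition support K p : R := sup [set dot p x | x in K].
Definition subdiff (g : 'rV[R]_m -> R) p : set 'rV[R]_m :=
  [set xi | forall q, g p + dot xi (q - p) <= g q].
(* The default value 0 is irrelevant for the nonempty closed convex sets to
   which this is applied. *)
Definition minnorm K : 'rV[R]_m :=
  xget 0 [set x | K x /\ forall y, K y -> enorm x <= enorm y].

End Euclidean.

(** Lebesgue measure on R^m, as the m-fold product of [lebesgue_measure],
    carried by the product sigma-algebra of [m.-tuple]. *)

Section LebesgueTuple.
Context {R : realType}.
Let RT := measurableTypeR R.

Definition tcons m (z : RT * m.-tuple RT) : m.+1.-tuple RT :=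
  [tuple of z.1 :: z.2].

Lemma measurable_tcons m : measurable_fun setT (@tcons m).
Proof. exact: measurable_cons. Qed.

Section Step.
Variables (m : nat) (mu : {sigma_finite_measure set (m.-tuple RT) -> \bar R}).

Definition lebesgue_step : set (m.+1.-tuple RT) -> \bar R :=
  pushforward (lebesgue_measure \x mu)%E (@tcons m).

Let step0 : lebesgue_step set0 = 0%E.
Proof. by rewrite /lebesgue_step /pushforward preimage_set0 measure0. Qed.

Let step_ge0 A : (0 <= lebesgue_step A)%E.
Proof. by rewrite /lebesgue_step /pushforward; apply: (measure_ge0 (lebesgue_measure \x mu)%E). Qed.

Let step_sigma_additive : semi_sigma_additive lebesgue_step.
Proof.
move=> F mF tF mUF; rewrite /lebesgue_step /pushforward preimage_bigcup.
have mc A : measurable A -> measurable (@tcons m @^-1` A).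
  by move=> mA; rewrite -[X in measurable X]setTI; exact: measurable_tcons.
apply: measure_semi_sigma_additive.
- by move=> k; exact: mc.
- apply/trivIsetP => /= i j _ _ ij; rewrite -preimage_setI.
  by move/trivIsetP : tF => /(_ _ _ _ _ ij) ->//; rewrite preimage_set0.
- by rewrite -preimage_bigcup; exact: mc.
Qed.

HB.instance Definition _ := isMeasure.Build _ _ _
  lebesgue_step step0 step_ge0 step_sigma_additive.

Let step_sigma_finite : sigma_finite setT lebesgue_step.
Proof.
have /sigma_finiteP[F [FT ndF Foo]] := sigma_finiteT (@lebesgue_measure R).
have /sigma_finiteP[G [GT ndG Goo]] := sigma_finiteT mu.
pose g (t : m.+1.-tuple RT) : RT * m.-tuple RT := (thead t, [tuple of behead t]).
have mg : measurable_fun setT g.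
  apply/measurable_fun_pairP; split.
  - exact: measurable_tnth.
  - exact: measurable_behead.
have gK : cancel (@tcons m) g.
  by move=> [a t]; congr pair; apply/val_inj.
exists (fun k => g @^-1` (F k `*` G k)).
  apply/seteqP; split=> // t _.
  have [i _ Fi] : (\bigcup_i F i) (g t).1 by rewrite -FT.
  have [j _ Gj] : (\bigcup_i G i) (g t).2 by rewrite -GT.
  exists (maxn i j) => //; split.
  - by move: Fi; exact/subsetPset/ndF/leq_maxl.
  - by move: Gj; exact/subsetPset/ndG/leq_maxr.
move=> k; have [mF muF] := Foo k; have [mG muG] := Goo k.
split.
  by rewrite -[X in measurable X]setTI; apply: mg => //; exact: measurableX.
rewrite /lebesgue_step /pushforward -comp_preimage.
rewrite (_ : g \o _ = id); last by apply/funext => z; exact: gK.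
by rewrite preimage_id product_measure1E// lte_mul_pinfty// ge0_fin_numE.
Qed.

HB.instance Definition _ :=
  Measure_isSigmaFinite.Build _ _ _ lebesgue_step step_sigma_finite.

End Step.

Fixpoint lebesgue_tuple (m : nat) :
    {sigma_finite_measure set (m.-tuple RT) -> \bar R} :=
  match m with
  | 0%N => \d_([tuple] : 0.-tuple RT)
  | k.+1 => lebesgue_step (lebesgue_tuple k)
  end.

End LebesgueTuple.

Section Steiner.
Context {R : realType} {m : nat}.

Definition row_of_tuple (t : m.-tuple (measurableTypeR R)) : 'rV[R]_m :=
  \row_i tnth t i.
Let B : set (m.-tuple (measurableTypeR R)) := row_of_tuple @^-1` eball 0 1.

Definition steiner (K : set 'rV[R]_m) : 'rV[R]_m :=
  (fine (lebesgue_tuple m B))^-1 *: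
  \row_i \int[lebesgue_tuple m]_(t in B)
    (minnorm (subdiff (support K) (row_of_tuple t)) 0 i).

End Steiner.

(** Functions on [0,T] are represented by functions on R, only the values on
    [0,T] being constrained or used.  Measurability in time is with respect to
    the completed (Lebesgue) sigma-algebra. *)

Section Admissible.
Context {R : realType}.
Variable T : R.

Definition lebesgue_measurable_fun (g : R -> R) : Prop :=
  measurable_fun
    (`[0, T] : set (g_sigma_algebraType
                      (completed_algebra_gen (@lebesgue_measure R))))
    (g : _ -> measurableTypeR R).

Record modulus (w : R -> R -> R) : Prop := {
  modulus_ge0 : forall t r, t \in `[0, T] -> 0 <= r -> 0 <= w t r ;
  modulus_measurable : forall r, 0 <= r -> lebesgue_measurable_fun (w ^~ r) ;
  modulus_nondecreasing : forall t r s, t \in `[0, T] ->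
    0 <= r -> r <= s -> w t r <= w t s ;
  modulus_continuous : forall t, t \in `[0, T] ->
    {within `[0, +oo[, continuous (w t)} ;
  modulus_subadditive : forall t r s, t \in `[0, T] ->
    0 <= r -> 0 <= s -> w t (r + s) <= w t r + w t s ;
  modulus0 : forall t, t \in `[0, T] -> w t 0 = 0 }.

Section Hamiltonian.
Variables (n : nat) (H : R -> 'rV[R]_n -> 'rV[R]_n -> R).
Variables (c : R -> R) (lam : R -> 'rV[R]_n -> R).

Definition lagrangian (t : R) (x v : 'rV[R]_n) : \bar R :=
  ereal_sup [set (dot v p - H t x p)%:E | p in [set: 'rV[R]_n]].

(* A point of R^(n+1) = R^n x R is a row vector z = (v, eta) of width n + 1. *)
Definition epiL (t : R) (x : 'rV[R]_n) : set 'rV[R]_(n + 1) :=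
  [set z | (lagrangian t x (lsubmx z) <= (rsubmx z 0 0)%:E)%E].

Record boundedly_admissible : Prop := {
  H_measurable : forall x p, lebesgue_measurable_fun (fun t => H t x p) ;
  H_continuous : forall t, t \in `[0, T] ->
    continuous (fun z : 'rV[R]_n * 'rV[R]_n => H t z.1 z.2) ;
  H_convex : forall t x p q (s : R), t \in `[0, T] -> 0 <= s <= 1 ->
    H t x (s *: p + (1 - s) *: q) <= s * H t x p + (1 - s) * H t x q ;
  c_ge0 : forall t, t \in `[0, T] -> 0 <= c t ;
  c_measurable : lebesgue_measurable_fun c ;
  H_lipschitz : forall t x p q, t \in `[0, T] ->
    `|H t x p - H t x q| <= c t * (1 + enorm x) * enorm (p - q) ;
  H_local : forall r, 0 < r ->
    exists (k : R -> R) (w : R -> R -> R) (N : set R),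
    [/\ lebesgue_measurable_fun k /\ (forall t, t \in `[0, T] -> 0 <= k t),
        modulus w,
        (@lebesgue_measure R).-negligible N &
        forall t x y p, t \in `[0, T] -> ~ N t ->
          eball 0 r x -> eball 0 r y ->
          `|H t x p - H t y p| <=
            k t * enorm p * enorm (x - y) + w t (enorm (x - y))] ;
  lam_measurable : forall x, lebesgue_measurable_fun (lam ^~ x) ;
  lam_continuous : forall t, t \in `[0, T] -> continuous (lam t) ;
  lagrangian_le : forall t x v, t \in `[0, T] ->
    lagrangian t x v \is a fin_num -> (lagrangian t x v <= (lam t x)%:E)%E ;
  lam_local : forall r, 0 < r ->
    exists (w : R -> R -> R) (N : set R),
    [/\ modulus w,
        (@lebesgue_measure R).-negligible N &
        forall t x y, t \in `[0, T] -> ~ N t ->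
          eball 0 r x -> eball 0 r y ->
          `|lam t x - lam t y| <= w t (enorm (x - y))] }.

Definition radius (t : R) (x : 'rV[R]_n) : R :=
  `|lam t x| + `|H t x 0| + c t * (1 + enorm x) + 1.

Definition canonical_e (t : R) (x : 'rV[R]_n) (a : 'rV[R]_(n + 1)) :
    'rV[R]_(n + 1) :=
  let b := radius t x *: a in
  steiner (epiL t x `&` eball b (2 * edist b (epiL t x))).
Definition canonical_f t x a : 'rV[R]_n := lsubmx (canonical_e t x a).
Definition canonical_l t x a : R := rsubmx (canonical_e t x a) 0 0.

End Hamiltonian.

End Admissible.

Definition cvg_locally_uniformly {U : topologicalType} {V : uniformType}
    (D : set U) (g_ : nat -> U -> V) (g : U -> V) : Prop :=
  {family compactly_in D, g_ i @[i --> \oo] --> g}.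

(* Main.v *)
Require Import Defs.
From mathcomp Require Import all_boot all_order all_algebra.
From mathcomp Require Import all_classical all_reals all_analysis.
From mathcomp Require Import measurable_realfun ring lra.
Import Order.TTheory GRing.Theory Num.Theory.
Import numFieldNormedType.Exports.
Local Open Scope classical_set_scope.
Local Open Scope ring_scope.

(** The value [canonical_e H c lam t x a] is the Steiner point of the part of
    the epigraph of [L(t,x,.)] that lies in the ball with centre [M a] and
    radius twice the distance from [M a] to the epigraph.  Uniform convergence
    on compact sets amounts to convergence along all sequences with an index
    tending to infinity and a convergent argument ([locally_uniformP],
    [locally_uniform_diag]), so a single statement has to be shown: if convex
    functions [h_ k] with a common Lipschitz constant converge pointwise to
    [h] and centres [b_ k] converge to [b], then the Steiner points of the
    truncated epigraphs of the conjugates converge.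

    - The epigraphs converge in the sense of Kuratowski.  A point outside the
      limit violates a strict inequality at one [p], which persists nearby
      ([epi_conj_upper]).  A point inside the limit is approximated by
      minimising [h_ k] minus an affine function plus a small multiple of
      [|p|^2]: the optimality condition produces an affine minorant of [h_ k]
      close to the given one ([epi_conj_lower]).

    - The distances to the epigraphs converge, and so do the support functions
      of the truncations ([support_trunc_upper], [support_trunc_lower]).  The
      factor two makes the truncation stable: when the distance [d] is
      positive, the open ball of radius [2 d] meets the convex epigraph, so
      every point of the truncation is a limit of points of the epigraph
      strictly inside the ball; when [d = 0] the truncations shrink to [b].

    - Pointwise convergence of the support functions of uniformly bounded
      compact sets gives convergence of the Steiner points ([cvg_steiner]).
      Such a support function is convex and Lipschitz; along each coordinate
      line its two one-sided derivatives differ at countably many points only,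
      so by Fubini they agree almost everywhere.  At such points the minimal
      norm subgradient is the vector of partial derivatives, these pass to the
      limit, and dominated convergence applies. *)

Set Implicit Arguments.
Unset Strict Implicit.
Unset Printing Implicit Defensive.

(** * Euclidean norm and inner product on row vectors *)

Section EuclideanSpace.
Context {R : realType} {m : nat}.
Implicit Types (x y z p q v : 'rV[R]_m) (a b r s : R) (K : set 'rV[R]_m).

Lemma dotC x y : dot x y = dot y x.
Proof. by apply: eq_bigr => i _; rewrite mulrC. Qed.

Lemma dotDl x y z : dot (x + y) z = dot x z + dot y z.
Proof. by rewrite -big_split /=; apply: eq_bigr => i _; rewrite mxE mulrDl. Qed.

Lemma dotZl a x y : dot (a *: x) y = a * dot x y.
Proof. by rewrite /dot mulr_sumr; apply: eq_bigr => i _; rewrite mxE mulrA. Qed.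

Lemma dotDr x y z : dot x (y + z) = dot x y + dot x z.
Proof. by rewrite dotC dotDl !(dotC x). Qed.

Lemma dotZr a x y : dot x (a *: y) = a * dot x y.
Proof. by rewrite dotC dotZl dotC. Qed.

Lemma dotNl x y : dot (- x) y = - dot x y.
Proof. by rewrite -scaleN1r dotZl mulN1r. Qed.

Lemma dotNr x y : dot x (- y) = - dot x y.
Proof. by rewrite dotC dotNl dotC. Qed.

Definition dotE := (dotDl, dotDr, dotZl, dotZr, dotNl, dotNr).

Lemma dot0l x : dot 0 x = 0.
Proof. by rewrite -(scale0r 0) dotZl mul0r. Qed.

Lemma dot_ge0 x : 0 <= dot x x.
Proof. by apply: sumr_ge0 => i _; rewrite -expr2 sqr_ge0. Qed.

Lemma enorm_ge0 x : 0 <= enorm x.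
Proof. exact: sqrtr_ge0. Qed.

Lemma enorm_sqr x : enorm x ^+ 2 = dot x x.
Proof. by rewrite sqr_sqrtr ?dot_ge0. Qed.

Lemma enorm0 : enorm (0 : 'rV[R]_m) = 0.
Proof. by rewrite /enorm dot0l sqrtr0. Qed.

Lemma enormZ a x : enorm (a *: x) = `|a| * enorm x.
Proof.
by rewrite /enorm dotZl dotZr mulrA -expr2 sqrtrM ?sqr_ge0// sqrtr_sqr.
Qed.

Lemma enormN x : enorm (- x) = enorm x.
Proof. by rewrite -scaleN1r enormZ normrN1 mul1r. Qed.

Lemma enormBC x y : enorm (x - y) = enorm (y - x).
Proof. by rewrite -enormN opprB. Qed.

Lemma coord_le_enorm x i : `|x 0 i| <= enorm x.
Proof.
rewrite -(@ler_pXn2r _ 2)// ?nnegrE ?enorm_ge0// enorm_sqr.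
rewrite /dot (bigD1 i)//= real_normK ?num_real// expr2 lerDl.
by apply: sumr_ge0 => j _; rewrite -expr2 sqr_ge0.
Qed.

Lemma enorm_eq0 x : enorm x = 0 -> x = 0.
Proof.
move=> x0; apply/rowP => i; rewrite mxE; apply/eqP; rewrite -normr_eq0.
by rewrite eq_le normr_ge0 andbT -x0 coord_le_enorm.
Qed.

(** The nonnegative quadratic [s |-> |x - s y|^2], taken at its minimum. *)
Lemma dot_le_enorm x y : dot x y <= enorm x * enorm y.
Proof.
have [y0|y0] := eqVneq (dot y y) 0.
  have -> : y = 0 by apply: enorm_eq0; rewrite /enorm y0 sqrtr0.
  by rewrite dotC dot0l enorm0 mulr0.
have yp : 0 < dot y y by rewrite lt_neqAle eq_sym y0 dot_ge0.
have [xy|xy] := leP (dot x y) 0.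
  by rewrite (le_trans xy)// mulr_ge0// enorm_ge0.
rewrite -(@ler_pXn2r _ 2)// ?nnegrE ?(ltW xy)// ?mulr_ge0 ?enorm_ge0//.
rewrite exprMn !enorm_sqr.
have := dot_ge0 (dot y y *: x - (dot x y) *: y).
rewrite !dotE !(dotC y x) => h.
rewrite -subr_ge0 -(pmulr_rge0 _ yp); apply: le_trans h _.
rewrite le_eqVlt; apply/orP; left; apply/eqP; ring.
Qed.

Lemma dot_abs_le_enorm x y : `|dot x y| <= enorm x * enorm y.
Proof.
by rewrite ler_norml dot_le_enorm andbT lerNl -dotNl -(enormN x) dot_le_enorm.
Qed.

Lemma enormD x y : enorm (x + y) <= enorm x + enorm y.
Proof.
rewrite -(@ler_pXn2r _ 2)// ?nnegrE ?addr_ge0 ?enorm_ge0//.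
rewrite enorm_sqr sqrrD !enorm_sqr !dotE (dotC y x).
have := dot_le_enorm x y; lra.
Qed.

Lemma enormB x y z : enorm (x - z) <= enorm (x - y) + enorm (y - z).
Proof. by rewrite (le_trans _ (enormD _ _))// addrA subrK. Qed.

Lemma enorm_sub_abs x y : `|enorm x - enorm y| <= enorm (x - y).
Proof.
have := enormD (x - y) y; have := enormD (y - x) x.
rewrite !subrK (enormBC y x) ler_norml => h1 h2; apply/andP; split; lra.
Qed.

(** With [enorm_le_norm], the equivalence with the max norm that carries the
    topology of row vectors. *)
Lemma norm_le_enorm x : `|x| <= enorm x.
Proof.
rewrite /Num.norm/= mx_normrE; apply/bigmax_leP; split; first exact: enorm_ge0.
by case=> i j _ /=; rewrite (ord1 i) coord_le_enorm.
Qed.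

Lemma enorm_le_norm x : enorm x <= m%:R * `|x|.
Proof.
have xi i : `|x 0 i| <= `|x|.
  rewrite [leRHS]/Num.norm/= mx_normrE.
  by apply: (@le_bigmax _ _ _ 0 (fun k => `|x k.1 k.2|) (0, i)).
have [m0|m0] := posnP m.
  have -> : x = 0 by apply/rowP => i; have := ltn_ord i; rewrite {2}m0.
  by rewrite enorm0 normr0 mulr0.
rewrite -(@ler_pXn2r _ 2)// ?nnegrE ?mulr_ge0 ?enorm_ge0//.
rewrite enorm_sqr exprMn (@le_trans _ _ (m%:R * `|x| ^+ 2))//; last first.
  by rewrite ler_wpM2r ?sqr_ge0// expr2 ler_peMr// ler1n.
apply: (@le_trans _ _ (\sum_(i < m) `|x| ^+ 2)).
  by apply: ler_sum => i _; rewrite -expr2 -(real_normK (num_real _)) lerXn2r ?nnegrE.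
by rewrite sumr_const card_ord mulr_natl.
Qed.

Lemma enorm_continuous : continuous (@enorm R m).
Proof.
move=> x; apply/(@cvgrPdist_lt _ _ _ (nbhs x) (nbhs_filter x)) => e e0.
have m0 : 0 < (m%:R + 1 : R) by rewrite ltr_wpDl.
have /cvgrPdist_lt /(_ (e / (m%:R + 1))) := @cvg_id _ (nbhs x).
move=> /(_ (divr_gt0 e0 m0)); apply: filterS => y.
rewrite ltr_pdivlMr// mulrC => xy; apply: le_lt_trans (enorm_sub_abs x y) _.
apply: le_lt_trans (enorm_le_norm _) _; apply: le_lt_trans xy.
by rewrite ler_wpM2r// lerDl.
Qed.

Lemma cvg_enormP (I : Type) (F : set_system I) {FF : Filter F}
    (u : I -> 'rV[R]_m) x :
  (forall e, 0 < e -> \forall i \near F, enorm (u i - x) <= e) ->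
  u i @[i --> F] --> x.
Proof.
move=> ux; apply/cvgrPdist_le => e e0; near=> i.
by rewrite (le_trans (norm_le_enorm _))// enormBC; near: i; exact: ux.
Unshelve. all: by end_near. Qed.

Lemma cvg_enorm_sub (I : Type) (F : set_system I) {FF : Filter F}
    (u v : I -> 'rV[R]_m) x y : u i @[i --> F] --> x -> v i @[i --> F] --> y ->
  enorm (u i - v i) @[i --> F] --> enorm (x - y).
Proof.
by move=> ux vy; apply: continuous_cvg; [exact: enorm_continuous|exact: cvgB].
Qed.

Lemma cvg_dotl (I : Type) (F : set_system I) {FF : Filter F}
    (u : I -> 'rV[R]_m) x q : u i @[i --> F] --> x ->
  dot (u i) q @[i --> F] --> dot x q.
Proof.
move=> ux; apply/cvgrPdist_lt => e e0.
have q0 : 0 < enorm q + 1 by rewrite ltr_wpDl// enorm_ge0.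
have : enorm (x - u i) @[i --> F] --> (0 : R).
  rewrite -enorm0 -(subrr x).
  by apply: cvg_enorm_sub => //; exact: cvg_cst.
move=> /cvgrPdist_lt /(_ _ (divr_gt0 e0 q0)); apply: filterS => i.
rewrite sub0r normrN ger0_norm ?enorm_ge0// ltr_pdivlMr// => h.
rewrite -dotNl -dotDl (le_lt_trans (dot_abs_le_enorm _ _))//.
apply: le_lt_trans h; rewrite ler_wpM2l ?enorm_ge0//; lra.
Qed.

Lemma eball_closed y r : closed (eball y r).
Proof.
have -> : eball y r = (fun z => enorm (z - y)) @^-1` [set s | s <= r] by [].
apply: preimage_closed; last exact: closed_le.
move=> z _.
by apply: (@cvg_enorm_sub _ (nbhs z) _ id (fun=> y)); [exact: cvg_id|exact: cvg_cst].
Qed.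

Lemma eball_compact y r : compact (eball y r).
Proof.
apply: bounded_closed_compact; last exact: eball_closed.
exists (r + enorm y); split; first exact: num_real.
move=> M /ltW rM z /= zy; rewrite (le_trans (norm_le_enorm z))//.
rewrite (le_trans _ rM)// -lerBlDr (le_trans _ zy)// lerBlDr.
by rewrite -[leLHS](congr1 enorm (subrK y z)) enormD.
Qed.

End EuclideanSpace.

(** * Directional derivatives of functions with bounded subgradients *)

Section DirectionalDerivative.
Context {R : realType} {m : nat}.
Implicit Types (g : 'rV[R]_m -> R) (p q v xi : 'rV[R]_m) (r s h : R).

(** For a real-valued function, having everywhere a subgradient of norm at most
    [r] amounts to being convex and [r]-Lipschitz; this form is immediate for
    support functions and is what the slope estimates use. *)
Definition subdifferentiable r g :=
  forall p, exists2 xi, subdiff g p xi & enorm xi <= r.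

Definition diffq g v p (n : nat) : R :=
  n.+1%:R * (g (p + n.+1%:R^-1 *: v) - g p).

(** The right derivative of [g] at [p] along [v], as the limit of a sequence so
    that measurability in [p] is inherited from the difference quotients. *)
Definition dder g v p : R := limn (diffq g v p).

Lemma subdiff_le_slope g p xi v h : 0 < h -> subdiff g p xi ->
  dot xi v <= (g (p + h *: v) - g p) / h.
Proof.
move=> h0 /(_ (p + h *: v)); rewrite addrAC subrr add0r dotZr => hp.
by rewrite ler_pdivlMr// mulrC lerBrDl.
Qed.

Lemma slope_le_subdiff g p xi v h : 0 < h -> subdiff g (p + h *: v) xi ->
  (g (p + h *: v) - g p) / h <= dot xi v.
Proof.
move=> h0 /(_ p); rewrite opprD addrA subrr add0r dotNr dotZr => hp.
by rewrite ler_pdivrMr// mulrC; lra.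
Qed.

(** Convexity along a line, read off from a subgradient at the inner point. *)
Lemma slope_nondecreasing r g p v h h' : subdifferentiable r g ->
  0 < h -> h <= h' -> (g (p + h *: v) - g p) / h <= (g (p + h' *: v) - g p) / h'.
Proof.
move=> sg h0 hh'; have h'0 := lt_le_trans h0 hh'.
have [xi gxi _] := sg (p + h *: v); have s1 := slope_le_subdiff h0 gxi.
have := gxi (p + h' *: v); rewrite opprD addrACA subrr add0r -scalerBl dotZr => s2.
rewrite ler_pdivlMr//; move: s1; set a := _ / h => s1.
have ah : g (p + h *: v) - g p = a * h by rewrite /a divfK// gt_eqF.
have : (h' - h) * a <= (h' - h) * dot xi v by rewrite ler_wpM2l// subr_ge0.
by move: s2 ah; lra.
Qed.

Lemma diffqE g v p n :
  diffq g v p n = (g (p + n.+1%:R^-1 *: v) - g p) / n.+1%:R^-1.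
Proof. by rewrite /diffq invrK mulrC. Qed.

Lemma diffq_nonincreasing r g v p : subdifferentiable r g ->
  {homo diffq g v p : i j / (i <= j)%N >-> j <= i}.
Proof.
move=> sg i j ij; rewrite !diffqE; apply: slope_nondecreasing sg _ _ => //.
by rewrite lef_pV2 ?posrE// ler_nat ltnS.
Qed.

Lemma diffq_cvg r g v p : subdifferentiable r g ->
  diffq g v p @ \oo --> dder g v p.
Proof.
move=> sg; apply: nonincreasing_is_cvgn.
  by move=> i j ij; exact: diffq_nonincreasing sg _ _ ij.
have [xi gxi _] := sg p; exists (dot xi v) => _ [n _ <-].
by rewrite diffqE; exact: subdiff_le_slope.
Qed.

Lemma dder_le_diffq r g v p n : subdifferentiable r g ->
  dder g v p <= diffq g v p n.
Proof.
move=> sg; have gc : diffq g v p @ \oo --> dder g v p by exact: diffq_cvg sg.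
apply: nonincreasing_cvgn_ge; last by apply/cvg_ex; exists (dder g v p).
by move=> i j ij; exact: diffq_nonincreasing sg _ _ ij.
Qed.

Lemma dder_le_slope r g v p h : subdifferentiable r g -> 0 < h ->
  dder g v p <= (g (p + h *: v) - g p) / h.
Proof.
move=> sg h0; have [n hn] : exists n, (n.+1%:R^-1 : R) <= h.
  by have [N _ hN] := near_infty_natSinv_lt (PosNum h0); exists N; exact/ltW/hN/leqnn.
apply: le_trans (dder_le_diffq v p n sg) _; rewrite diffqE.
exact: slope_nondecreasing sg _ _.
Qed.

Lemma subdiff_le_dder r g v p xi : subdifferentiable r g ->
  subdiff g p xi -> dot xi v <= dder g v p.
Proof.
move=> sg gxi; apply: limr_ge.
  by apply/cvg_ex; exists (dder g v p); exact: diffq_cvg sg.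
by apply: nearW => n; rewrite diffqE; exact: subdiff_le_slope.
Qed.

Lemma dder_norm_le r g v p : subdifferentiable r g ->
  `|dder g v p| <= r * enorm v.
Proof.
move=> sg; rewrite ler_norml; apply/andP; split.
  have [xi gxi xir] := sg p; apply: le_trans (subdiff_le_dder v sg gxi).
  rewrite lerNl -dotNr; apply: le_trans (dot_le_enorm _ _) _.
  by rewrite enormN ler_wpM2r ?enorm_ge0.
have [xi gxi xir] := sg (p + 1 *: v).
apply: le_trans (dder_le_slope v p sg ltr01) _.
apply: le_trans (slope_le_subdiff ltr01 gxi) _.
by rewrite (le_trans (dot_le_enorm _ _))// ler_wpM2r ?enorm_ge0.
Qed.

Lemma subdifferentiable_lipschitz r g p q : subdifferentiable r g ->
  `|g p - g q| <= r * enorm (p - q).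
Proof.
move=> sg; wlog gpq : p q / g q <= g p.
  move=> W; have [|/ltW] := leP (g q) (g p); first exact: W.
  by rewrite distrC enormBC; exact: W.
rewrite ger0_norm ?subr_ge0//; have [xi gxi xir] := sg p.
have := gxi q; rewrite -opprB dotNr => gq.
apply: (@le_trans _ _ (dot xi (p - q))); first by lra.
by rewrite (le_trans (dot_le_enorm _ _))// ler_wpM2r ?enorm_ge0.
Qed.

Lemma lipschitz_continuous r g :
  (forall p q, `|g p - g q| <= r * enorm (p - q)) -> continuous g.
Proof.
move=> gr p.
apply/(@cvgrPdist_le _ _ _ (nbhs p) (nbhs_filter p)) => e e0.
have h : enorm (p - q) @[q --> p] --> enorm (p - p).
  apply: (@cvg_enorm_sub _ _ _ (nbhs p) _ (fun=> p) id); first exact: cvg_cst.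
  exact: cvg_id.
have : r * enorm (p - q) @[q --> p] --> r * enorm (p - p).
  exact: (@cvgM _ _ _ _ _ _ _ _ (cvg_cst r) h).
rewrite subrr enorm0 mulr0 => /cvgrPdist_le /(_ _ e0); apply: filterS => q.
rewrite sub0r normrN => {}h; apply: le_trans (gr p q) _.
by apply: le_trans h; exact: ler_norm.
Qed.

(** The upper limit of the derivatives of [g_ k] along any direction is bounded
    by the difference quotients of [g], hence by its derivative.  Used along
    both [v] and [- v], this squeezes the derivatives along [v] as soon as the
    two one-sided derivatives of [g] agree. *)
Lemma dder_cvg r (g_ : nat -> 'rV[R]_m -> R) g v p :
  (forall k, subdifferentiable r (g_ k)) -> subdifferentiable r g ->
  (forall q, g_ k q @[k --> \oo] --> g q) ->
  dder g v p + dder g (- v) p = 0 ->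
  dder (g_ k) v p @[k --> \oo] --> dder g v p.
Proof.
move=> sg_ sg gg gv.
have up w e : 0 < e -> \forall k \near \oo, dder (g_ k) w p < dder g w p + e.
  move=> e0; have [n gn] : exists n, diffq g w p n < dder g w p + e.
    near \oo => n; exists n; rewrite -ltrBlDl; apply: le_lt_trans (ler_norm _) _.
    near: n; have h : diffq g w p @ \oo --> dder g w p by exact: diffq_cvg sg.
    have /cvgrPdist_lt := h.
    by move=> /(_ _ e0); apply: filterS => n; rewrite distrC.
  have : diffq (g_ k) w p n @[k --> \oo] --> diffq g w p n.
    exact: (cvgM (cvg_cst _) (cvgB (gg _) (gg _))).
  move=> h; near=> k; apply: le_lt_trans (dder_le_diffq _ _ n (sg_ k)) _.
  by near: k; exact: (@cvgr_lt _ _ _ _ _ _ h _ gn).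
apply/cvgrPdist_lt => e e0.
near=> k.
have h1 : dder (g_ k) v p < dder g v p + e by near: k; exact: up.
have h2 : dder (g_ k) (- v) p < dder g (- v) p + e by near: k; exact: up.
have [xi gxi _] := sg_ k p.
have := subdiff_le_dder v (sg_ k) gxi; have := subdiff_le_dder (- v) (sg_ k) gxi.
by rewrite dotNr ltr_norml => *; apply/andP; split; lra.
Unshelve. all: by end_near. Qed.

(** The subdifferential determines each coordinate of its elements where the
    two one-sided derivatives along that coordinate agree. *)
Lemma minnorm_subdiffE r g p : subdifferentiable r g ->
  (forall i, dder g (delta_mx 0 i) p + dder g (- delta_mx 0 i) p = 0) ->
  forall i, minnorm (subdiff g p) 0 i = dder g (delta_mx 0 i) p.
Proof.
move=> sg gp.
have E xi : subdiff g p xi -> xi = \row_i dder g (delta_mx 0 i) p.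
  move=> gxi; apply/rowP => i; rewrite mxE.
  have -> : xi 0 i = dot xi (delta_mx 0 i).
    rewrite /dot (bigD1 i)//= big1 ?addr0; first by rewrite mxE !eqxx mulr1.
    by move=> j /negbTE ji; rewrite mxE ji andbF mulr0.
  have := subdiff_le_dder (delta_mx 0 i) sg gxi.
  have := subdiff_le_dder (- delta_mx 0 i) sg gxi.
  by rewrite dotNr => h1 h2; apply/eqP; rewrite eq_le h2/=; have := gp i; lra.
move=> i; have [xi gxi _] := sg p.
have : [set x | subdiff g p x /\ forall y, subdiff g p y -> enorm x <= enorm y]
    (minnorm (subdiff g p)).
  by apply: (xgetPex 0); exists xi; split=> // y /E ->; rewrite (E _ gxi).
by case=> /E -> _; rewrite mxE.
Qed.

(** The open intervals between the two one-sided derivatives are nonempty and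
    pairwise disjoint, so each kink owns a rational. *)
Lemma countable_kinks r g p v : subdifferentiable r g ->
  countable [set s | dder g v (p + s *: v) + dder g (- v) (p + s *: v) != 0].
Proof.
move=> sg.
have gap s : exists q : rat, dder g v (p + s *: v) + dder g (- v) (p + s *: v) != 0 ->
    - dder g (- v) (p + s *: v) < ratr q < dder g v (p + s *: v).
  have [E0|ne0] := eqVneq (dder g v (p + s *: v) + dder g (- v) (p + s *: v)) 0.
    by exists 0.
  have [xi gxi _] := sg (p + s *: v).
  have h1 := subdiff_le_dder v sg gxi; have h2 := subdiff_le_dder (- v) sg gxi.
  have : - dder g (- v) (p + s *: v) < dder g v (p + s *: v).
    rewrite -subr_gt0 opprK lt_neqAle eq_sym ne0/=.
    by move: h2; rewrite dotNr; lra.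
  by move=> /rat_in_itvoo[q]; rewrite in_itv/= => hq; exists q.
pose f s := projT1 (cid (gap s)).
have fP s := projT2 (cid (gap s)).
have mono s s' : s < s' -> dder g v (p + s *: v) <= - dder g (- v) (p + s' *: v).
  move=> ss'; have h0 : 0 < s' - s by rewrite subr_gt0.
  have := dder_le_slope v (p + s *: v) sg h0.
  have := dder_le_slope (- v) (p + s' *: v) sg h0.
  have -> : p + s *: v + (s' - s) *: v = p + s' *: v.
    by rewrite -addrA -scalerDl subrKC.
  have -> : p + s' *: v + (s' - s) *: - v = p + s *: v.
    by rewrite scalerN -addrA -scalerBl opprB subrKC.
  rewrite -[g (p + s *: v) - _]opprB mulNr; lra.
apply/countable_injP; exists (pickle \o f) => s s'; rewrite !inE /= => s0 s'0.
move=> /(pcan_inj pickleK) ff'.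
have : forall u u', u < u' ->
    dder g v (p + u *: v) + dder g (- v) (p + u *: v) != 0 ->
    dder g v (p + u' *: v) + dder g (- v) (p + u' *: v) != 0 -> f u <> f u'.
  move=> u u' /mono uu' /fP /andP[_ h1] /fP /andP[h2 _] fuu'.
  have := lt_trans (lt_le_trans h1 uu') h2.
  by rewrite -/(f u) -/(f u') fuu' ltxx.
move=> W; case: (ltgtP s s') => // ss'.
  by case: (W _ _ ss' s0 s'0).
by case: (W _ _ ss' s'0 s0).
Qed.

End DirectionalDerivative.

(** * Integration and null sets on tuples of reals *)

Section NonmeasurableIntegrand.
Import HBNNSimple.
Context d (T : measurableType d) (R : realType) (mu : {measure set T -> \bar R}).
Local Open Scope ereal_scope.

Lemma ge0_integral_setD_null (D N : set T) (f : T -> \bar R) :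
  measurable N -> mu N = 0 -> (forall x, 0 <= f x) ->
  \int[mu]_(x in D) f x = \int[mu]_(x in D `\` N) f x.
Proof.
move=> mN N0 f0; rewrite !ge0_integralE//=.
have r0 E x : 0 <= (f \_ E) x by rewrite patchE; case: ifP.
apply/eqP; rewrite eq_le; apply/andP; split; last first.
  apply: ereal_sup_le => _ [h hf <-]; exists h => //= x.
  apply: le_trans (hf x) _; rewrite !patchE.
  case: ifPn => [|_]; last by case: ifP.
  by rewrite inE => -[Dx _]; rewrite mem_set.
apply: ge_ereal_sup => _ [h hf <-].
pose h' := proj_nnsfun h (measurableC mN).
apply: le_ereal_sup_tmp; exists (sintegral mu h'); last first.
  rewrite -!integralT_nnsfun.
  suff -> : \int[mu]_x (h x)%:E = \int[mu]_x (h' x)%:E by [].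
  apply: ae_eq_integral => //.
  - exact/measurable_EFinP.
  - exact/measurable_EFinP.
  - exists N; split => // x /= /not_implyP[_]; apply: contra_notP => Nx.
    by rewrite mindicE mem_set// mulr1.
exists h' => // x; rewrite /= mindicE patchE.
have [|xN] := boolP (x \in ~` N); last by rewrite mulr0 -patchE r0.
rewrite inE mulr1 => xN; apply: le_trans (hf x) _; rewrite patchE.
by case: ifPn => [|_]; [rewrite inE => Dx; rewrite mem_set|case: ifP].
Qed.

(** Changing the integrand on a null set is harmless even when it is not known
    to be measurable: a simple function below it may be cut off on the null
    set without changing its integral. *)
Lemma integral_setD_null (D N : set T) (f : T -> \bar R) :
  measurable N -> mu N = 0 ->
  \int[mu]_(x in D) f x = \int[mu]_(x in D `\` N) f x.
Proof.
move=> mN N0; rewrite integralE [RHS]integralE.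
by congr (_ - _); exact: ge0_integral_setD_null.
Qed.

End NonmeasurableIntegrand.

Section LebesgueTupleTheory.
Context {R : realType}.
Let RT := measurableTypeR R.

Definition set_coord m (j : 'I_m) (s : RT) (t : m.-tuple RT) : m.-tuple RT :=
  [tuple if i == j then s else tnth t i | i < m].

Lemma set_coord0 m s (y : m.-tuple RT) (x : RT) :
  set_coord ord0 s (tcons (x, y)) = tcons (s, y).
Proof.
apply: eq_from_tnth => i; rewrite tnth_mktuple.
case: (unliftP ord0 i) => [k ->|->]; last by rewrite eqxx.
by rewrite eq_sym (negbTE (neq_lift _ _)) !tnthS.
Qed.

Lemma set_coordS m (j : 'I_m) s (y : m.-tuple RT) (x : RT) :
  set_coord (lift ord0 j) s (tcons (x, y)) = tcons (x, set_coord j s y).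
Proof.
apply: eq_from_tnth => i; rewrite tnth_mktuple.
case: (unliftP ord0 i) => [k ->|->]; last by rewrite (negbTE (neq_lift _ _)).
by rewrite (inj_eq lift_inj) !tnthS tnth_mktuple.
Qed.

(** By Fubini, integrating first along the coordinate [j]. *)
Lemma lebesgue_tuple_null_sections m (j : 'I_m) (A : set (m.-tuple RT)) :
  measurable A ->
  (forall t, lebesgue_measure [set s | A (set_coord j s t)] = 0%E) ->
  lebesgue_tuple m A = 0%E.
Proof.
elim: m j A => [[]//|m IH] j A mA A0.
have mA' : measurable (@tcons R m @^-1` A).
  by rewrite -[X in measurable X]setTI; exact: measurable_tcons.
rewrite [LHS](_ : _ =
  (lebesgue_measure \x lebesgue_tuple m)%E (@tcons R m @^-1` A))//.
case: (unliftP ord0 j) A0 => [k ->|->] A0.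
  apply: integral0_eq => x _ /=; apply: (IH k); first exact: measurable_xsection.
  move=> t; rewrite -(A0 (tcons (x, t))); congr lebesgue_measure.
  by apply/seteqP; split=> s /=; rewrite /xsection /= inE set_coordS.
rewrite (@product_measure_unique _ _ _ _ _ _ _
  (lebesgue_measure \x^ lebesgue_tuple m)%E)//; last first.
  by move=> *; exact: product_measure2E.
apply: integral0_eq => y _ /=; rewrite -[RHS](A0 (tcons (0, y))).
congr lebesgue_measure.
by apply/seteqP; split=> s /=; rewrite /ysection /= inE set_coord0.
Qed.

Lemma measurable_tuple_box m (A : set R) : measurable A ->
  measurable [set t : m.-tuple RT | forall i, A (tnth t i)].
Proof.
move=> mA.
have -> : [set t : m.-tuple RT | forall i, A (tnth t i)] =
    \bigcap_(i in [set: 'I_m]) ((@tnth m RT)^~ i @^-1` A).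
  by apply/seteqP; split=> t /= tA => [i _|i]; exact: tA.
apply: fin_bigcap_measurable => // i _; rewrite -[X in measurable X]setTI.
exact: measurable_tnth.
Qed.

Definition cube m : set (m.-tuple RT) :=
  [set t | forall i, (`[-1, 1]%classic : set R) (tnth t i)].

Lemma measurable_cube m : measurable (@cube m).
Proof. exact: measurable_tuple_box. Qed.

Lemma lebesgue_tuple_cube_lty m : (lebesgue_tuple m (@cube m) < +oo)%E.
Proof.
elim: m => [|m IH]; first by rewrite /= diracE; case: (_ \in _); rewrite ltry.
rewrite [X in (X < _)%E](_ : _ =
  (lebesgue_measure \x lebesgue_tuple m)%E (@tcons R m @^-1` (@cube m.+1)))//.
have -> : @tcons R m @^-1` (@cube m.+1) = `[-1, 1] `*` @cube m.
  apply/seteqP; split=> [[x y] /= h|[x y] /= [hx hy] i].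
    by split=> [|i]; [exact: (h ord0)|have := h (lift ord0 i); rewrite tnthS].
  by case: (unliftP ord0 i) => [k ->|->]; rewrite ?tnthS//; exact: hy.
rewrite product_measure1E//; last exact: measurable_cube.
rewrite lte_mul_pinfty//.
by have := @lebesgue_measure_itv R `[-1, 1]; rewrite /= => ->; case: ifP.
Qed.

(** Rounding the argument down to a grid leaves countably many values, hence
    measurable approximations that converge to [f] by continuity. *)
Lemma measurable_comp_row_of_tuple m (f : 'rV[R]_m -> R) : continuous f ->
  measurable_fun setT (fun t : m.-tuple RT => f (row_of_tuple t)).
Proof.
move=> cf.
pose z k (t : m.-tuple RT) : {ffun 'I_m -> int} :=
  [ffun i => Num.floor (k.+1%:R * tnth t i)].
pose F k (a : {ffun 'I_m -> int}) : R := f (\row_i ((a i)%:~R / k.+1%:R)).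
apply: (@measurable_fun_cvg _ _ _ _ (fun k t => F k (z k t))) => [k|t _]; last first.
  apply: continuous_cvg; first exact: cf.
  apply: cvg_enormP => e e0.
  have d0 : 0 < e / (m%:R + 1) by rewrite divr_gt0// ltr_wpDl.
  near=> k.
  apply: le_trans (enorm_le_norm _) _.
  apply: (@le_trans _ _ (m%:R * k.+1%:R^-1)).
    rewrite ler_wpM2l// [leLHS]/Num.norm/= mx_normrE; apply/bigmax_leP; split=> //.
    case=> i j _; rewrite !mxE ffunE /=.
    have k0 : k.+1%:R != 0 :> R by rewrite pnatr_eq0.
    set x : R := tnth t j.
    rewrite -[X in _ - X](mulfK k0) -mulrBl normrM (mulrC x).
    rewrite [X in _ * X]gtr0_norm ?invr_gt0// ler_piMl//.
    rewrite distrC ger0_norm ?subr_ge0 ?floor_le//.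
    by have := floorD1_gt (k.+1%:R * x); rewrite intrD; lra.
  apply: (@le_trans _ _ ((m%:R + 1) * (e / (m%:R + 1)))); last first.
    by rewrite mulrC divfK// gt_eqF// ltr_wpDl.
  apply: ler_pM => //; first by rewrite lerDl.
  by apply: ltW; near: k; exact: (near_infty_natSinv_lt (PosNum d0)).
move=> _ Y mY; rewrite setTI.
have -> : (fun t => F k (z k t)) @^-1` Y =
    \bigcup_a [set t | Y (F k a) /\ z k t = a].
  by apply/seteqP; split=> [t Yt|t [a _ [Ya za]]]; [exists (z k t)|rewrite /= za].
apply: countable_bigcupT_measurable => // a.
have [Ya|nYa] := pselect (Y (F k a)); last first.
  by rewrite [X in measurable X](_ : _ = set0)//; apply/seteqP; split=> t // -[].
have -> : [set t | Y (F k a) /\ z k t = a] = \bigcap_(i in [set: 'I_m])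
    ((@tnth m RT)^~ i @^-1` `[(a i)%:~R / k.+1%:R, (a i + 1)%:~R / k.+1%:R[).
  have E t i : (Num.floor (k.+1%:R * tnth t i) == a i) =
      ((tnth t i : R) \in `[(a i)%:~R / k.+1%:R, (a i + 1)%:~R / k.+1%:R[).
    by rewrite floor_eq in_itv/= ler_pdivrMr// ltr_pdivlMr// mulrC.
  apply/seteqP; split=> [t [_ za] i _ /=|t h].
    by rewrite -E -za ffunE.
  split=> //; apply/ffunP => i; rewrite ffunE; apply/eqP; rewrite E.
  exact: (h i).
apply: fin_bigcap_measurable => // i _; rewrite -[X in measurable X]setTI.
exact: measurable_tnth.
Unshelve. all: by end_near. Qed.

End LebesgueTupleTheory.

(** * Continuity of the Steiner point *)

Section SupportFunction.
Context {R : realType} {m : nat}.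
Implicit Types (K : set 'rV[R]_m) (p q x : 'rV[R]_m) (r : R).

Lemma cvg_rowP (I : Type) (F : set_system I) {FF : Filter F}
    (u : I -> 'rV[R]_m) x :
  (forall j, u i 0 j @[i --> F] --> x 0 j) -> u i @[i --> F] --> x.
Proof.
move=> ux; apply: cvg_enormP => e e0.
have d0 : 0 < e / (m%:R + 1) by rewrite divr_gt0// ltr_wpDl.
have H : \forall i \near F, forall j, `|x 0 j - u i 0 j| <= e / (m%:R + 1).
  apply: filter_forall => j; have /cvgrPdist_le := ux j; exact.
near=> i; apply: le_trans (enorm_le_norm _) _.
apply: (@le_trans _ _ ((m%:R + 1) * (e / (m%:R + 1)))); last first.
  by rewrite mulrC divfK// gt_eqF// ltr_wpDl.
apply: ler_pM => //; first by rewrite lerDl.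
rewrite [leLHS]/Num.norm/= mx_normrE; apply/bigmax_leP; split=> [|[a j] _].
  exact: ltW.
by rewrite !mxE (ord1 a) distrC; move: j; near: i.
Unshelve. all: by end_near. Qed.

Lemma le_support K r p x : K `<=` eball 0 r -> K x -> dot p x <= Defs.support K p.
Proof.
move=> Kr Kx; apply: ub_le_sup; last by exists x.
exists (enorm p * r) => _ [y Ky <-]; apply: le_trans (dot_le_enorm _ _) _.
by rewrite ler_wpM2l ?enorm_ge0//; have := Kr _ Ky; rewrite /eball/= subr0.
Qed.

Lemma support_attained K p : compact K -> K !=set0 ->
  exists2 x, K x & Defs.support K p = dot p x.
Proof.
move=> cK K0.
have [|x xK xm] := @EVT_max_rV R m (fun y => dot y p) K K0 cK.
  apply: continuous_subspaceT => y.
  by apply: (@cvg_dotl _ _ _ (nbhs y) _ id); exact: cvg_id.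
exists x; first by rewrite inE in xK.
apply/eqP; rewrite eq_le; apply/andP; split.
  apply: ge_sup; first by exists (dot p x); exists x => //; rewrite inE in xK.
  by move=> _ [y Ky <-]; rewrite !(dotC p) xm// inE.
apply: ub_le_sup; last by exists x => //; rewrite inE in xK.
by exists (dot x p) => _ [y Ky <-]; rewrite (dotC p) xm// inE.
Qed.

(** A point of [K] at which the maximum defining the support function is attained
    is a subgradient, and it is bounded as [K] is. *)
Lemma support_subdifferentiable K r : compact K -> K !=set0 ->
  K `<=` eball 0 r -> subdifferentiable r (Defs.support K).
Proof.
move=> cK K0 Kr p; have [x Kx px] := support_attained p cK K0.
exists x; last by have := Kr _ Kx; rewrite /eball/= subr0.
move=> q; rewrite px dotDr dotNr !(dotC x).
by rewrite addrCA subrr addr0; exact: le_support Kr Kx.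
Qed.

End SupportFunction.

Section SteinerContinuity.
Context {R : realType} {m : nat}.
Let RT := measurableTypeR R.
Let mu : {sigma_finite_measure set (m.-tuple RT) -> \bar R} := lebesgue_tuple m.
Implicit Types (g : 'rV[R]_m -> R) (K : set 'rV[R]_m) (r : R).

Let ball : set (m.-tuple RT) := row_of_tuple @^-1` eball (0 : 'rV[R]_m) 1.

Lemma measurable_unit_ball : measurable ball.
Proof.
have -> : ball = (fun t => enorm (row_of_tuple t)) @^-1` `]-oo, 1].
  by apply/seteqP; split=> t; rewrite /ball /eball /= in_itv/= subr0.
rewrite -[X in measurable X]setTI.
exact: (measurable_comp_row_of_tuple (@enorm_continuous R m)).
Qed.

Lemma unit_ball_lty : (mu ball < +oo)%E.
Proof.
apply: le_lt_trans (@lebesgue_tuple_cube_lty R m).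
apply: le_measure; rewrite ?inE; [exact: measurable_unit_ball|exact: measurable_cube|].
move=> t; rewrite /ball /eball /= subr0 => t1 i; rewrite /= in_itv/= -ler_norml.
by apply: le_trans t1; have := coord_le_enorm (row_of_tuple t) i; rewrite mxE.
Qed.

Lemma measurable_dder r g v : subdifferentiable r g ->
  measurable_fun setT (fun t : m.-tuple RT => dder g v (row_of_tuple t)).
Proof.
move=> sg.
apply: (@measurable_fun_cvg _ _ _ _ (fun n t => diffq g v (row_of_tuple t) n)).
  move=> n; apply: measurable_funM; first exact: measurable_cst.
  apply: measurable_funB.
    apply: (@measurable_comp_row_of_tuple _ _ (fun p => g (p + n.+1%:R^-1 *: v))).
    apply: (@lipschitz_continuous _ _ r) => p q.
    have := subdifferentiable_lipschitz (p + n.+1%:R^-1 *: v) (q + n.+1%:R^-1 *: v) sg.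
    by rewrite opprD addrACA subrr addr0.
  apply: measurable_comp_row_of_tuple.
  by apply: (@lipschitz_continuous _ _ r) => p q; exact: subdifferentiable_lipschitz.
by move=> t _; exact: diffq_cvg sg.
Qed.

Definition kinks g : set (m.-tuple RT) := \bigcup_(i in [set: 'I_m])
  [set t | dder g (delta_mx 0 i) (row_of_tuple t) +
           dder g (- delta_mx 0 i) (row_of_tuple t) != 0].

Lemma measurable_kink r g i : subdifferentiable r g ->
  measurable [set t : m.-tuple RT | dder g (delta_mx 0 i) (row_of_tuple t) +
           dder g (- delta_mx 0 i) (row_of_tuple t) != 0].
Proof.
move=> sg; pose h (t : m.-tuple RT) := dder g (delta_mx 0 i) (row_of_tuple t) +
           dder g (- delta_mx 0 i) (row_of_tuple t).
rewrite (_ : [set t | _] = setT `&` h @^-1` (~` [set 0])).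
  apply: measurable_funD; [exact: measurable_dder sg|exact: measurable_dder sg|by []|].
  by apply: measurableC; exact: measurable_set1.
by rewrite setTI; apply/seteqP; split=> t /=; rewrite -/(h t) => /eqP.
Qed.

Lemma row_of_set_coord (i : 'I_m) s (t : m.-tuple RT) :
  row_of_tuple (set_coord i s t) =
  row_of_tuple (set_coord i 0 t) + s *: delta_mx 0 i.
Proof.
apply/rowP => j; rewrite !mxE !tnth_mktuple eqxx /=.
by case: eqP => _; rewrite ?add0r ?mulr1 ?mulr0 ?addr0.
Qed.

(** On each line parallel to a coordinate axis there are countably many kinks. *)
Lemma negligible_kinks r g : subdifferentiable r g -> mu.-negligible (kinks g).
Proof.
move=> sg; rewrite /kinks (_ : [set: 'I_m] = [set` index_enum 'I_m]); last first.
  by apply/seteqP; split=> i //= _; rewrite mem_index_enum.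
rewrite bigcup_seq; elim/big_ind : _ => [|A B|i _].
- exact: negligible_set0.
- exact: negligibleU.
apply/negligibleP; first exact: measurable_kink sg.
apply: (lebesgue_tuple_null_sections (j := i)); first exact: measurable_kink sg.
move=> t; apply: countable_lebesgue_measure0.
have := countable_kinks (row_of_tuple (set_coord i 0 t)) (delta_mx 0 i) sg.
apply: sub_countable; apply: subset_card_le => s /=.
by rewrite row_of_set_coord.
Qed.

Lemma minnorm_off_kinks r g t i : subdifferentiable r g -> ~ kinks g t ->
  minnorm (subdiff g (row_of_tuple t)) 0 i =
  dder g (delta_mx 0 i) (row_of_tuple t).
Proof.
move=> sg gt; apply: minnorm_subdiffE sg _ i => j; apply/eqP/negPn/negP => j0.
by apply: gt; exists j.
Qed.

(** Almost every point of the ball is a kink of none of the functions; there the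
    minimal norm subgradient consists of the partial derivatives, and these
    converge.  Off the exceptional null set the selection [minnorm] is also a
    measurable function of the point. *)
Lemma cvg_integral_minnorm r (g_ : nat -> 'rV[R]_m -> R) g i :
  (forall k, subdifferentiable r (g_ k)) -> subdifferentiable r g ->
  (forall q, g_ k q @[k --> \oo] --> g q) ->
  \int[mu]_(t in ball) (minnorm (subdiff (g_ k) (row_of_tuple t)) 0 i)
    @[k --> \oo] -->
  \int[mu]_(t in ball) (minnorm (subdiff g (row_of_tuple t)) 0 i).
Proof.
move=> sg_ sg gg.
have [N [mN N0 kN]] : mu.-negligible (kinks g `|` \bigcup_k kinks (g_ k)).
  apply: negligibleU; first exact: negligible_kinks sg.
  by apply: negligible_bigcup => k; exact: negligible_kinks (sg_ k).
have mD : measurable (ball `\` N).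
  by apply: measurableD => //; exact: measurable_unit_ball.
have E h : subdifferentiable r h -> kinks h `<=` N ->
    \int[mu]_(t in ball) (minnorm (subdiff h (row_of_tuple t)) 0 i) =
    fine (\int[mu]_(t in ball `\` N) (dder h (delta_mx 0 i) (row_of_tuple t))%:E)%E.
  move=> sh hN; rewrite /Rintegral (integral_setD_null _ _ mN N0); congr fine.
  apply: eq_integral => t; rewrite inE => -[_ Nt]; rewrite (minnorm_off_kinks _ sh)//.
  by move=> /hN.
rewrite (E g)//; last by apply: subset_trans kN; left.
rewrite (_ : (fun k => _) = fun k => fine (\int[mu]_(t in ball `\` N)
    (dder (g_ k) (delta_mx 0 i) (row_of_tuple t))%:E)%E); last first.
  apply/funext => k; apply: E => //; apply: subset_trans kN => t kt; right.
  by exists k.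
pose M := r * enorm (delta_mx 0 i : 'rV[R]_m).
have iM : mu.-integrable (ball `\` N) (EFin \o cst M).
  apply/integrableP; split; first exact/measurable_EFinP/measurable_cst.
  under eq_integral do rewrite /=.
  rewrite integral_cst//; apply: lte_mul_pinfty => //.
  apply: le_lt_trans unit_ball_lty; apply: le_measure; rewrite ?inE//.
  exact: measurable_unit_ball.
have md h : subdifferentiable r h -> measurable_fun (ball `\` N)
    (fun t => (dder h (delta_mx 0 i) (row_of_tuple t))%:E).
  move=> sh; apply/measurable_EFinP; apply: measurable_funTS.
  exact: measurable_dder sh.
apply: fine_cvg; rewrite fineK; last first.
  apply: integrable_fin_num => //; apply: le_integrable iM => //; first exact: md.
  move=> t _ /=; rewrite lee_fin (le_trans (dder_norm_le _ _ sg))//.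
  exact: ler_norm.
apply: (@dominated_cvg _ _ _ _ _ mD _ _ (EFin \o cst M)) => //.
- by move=> k; exact: md.
- move=> t [_ Nt]; apply: cvg_EFin; first exact: nearW.
  apply: dder_cvg sg_ sg gg _; apply/eqP/negPn/negP => j0.
  by apply: Nt; apply: kN; left; exists i.
- by move=> k t _ /=; rewrite lee_fin; exact: dder_norm_le (sg_ k).
Qed.

(** The normalising volume of the ball is the same for all sets, so only the
    integrals matter. *)
Lemma cvg_steiner r (K_ : nat -> set 'rV[R]_m) K :
  (forall k, [/\ compact (K_ k), K_ k !=set0 & K_ k `<=` eball 0 r]) ->
  [/\ compact K, K !=set0 & K `<=` eball 0 r] ->
  (forall q, Defs.support (K_ k) q @[k --> \oo] --> Defs.support K q) ->
  steiner (K_ k) @[k --> \oo] --> steiner K.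
Proof.
move=> cK_ [cK K0 Kr] KK; apply: cvg_rowP => i.
rewrite (_ : (fun k => _) = fun k => (fine (mu ball))^-1 *
   \int[mu]_(t in ball) (minnorm (subdiff (Defs.support (K_ k)) (row_of_tuple t)) 0 i)).
  rewrite !mxE; apply: (cvgM (cvg_cst _)).
  apply: (@cvg_integral_minnorm r (fun k => Defs.support (K_ k))) => //.
    by move=> k; have [? ? ?] := cK_ k; exact: support_subdifferentiable.
  exact: support_subdifferentiable.
by apply/funext => k; rewrite !mxE.
Qed.

End SteinerContinuity.

(** * Truncation of a convergent sequence of convex sets *)

Section Truncation.
Context {R : realType} {m : nat}.
Implicit Types (E K C : set 'rV[R]_m) (b z q : 'rV[R]_m).

Lemma near_enorm_lt z (e : R) : 0 < e -> \forall z' \near z, enorm (z' - z) < e.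
Proof.
move=> e0; have h : enorm (z' - z) @[z' --> z] --> enorm (z - z).
  apply: (@cvg_enorm_sub _ _ _ (nbhs z) _ id (fun=> z)); first exact: cvg_id.
  exact: cvg_cst.
have ee : enorm (z - z) < e by rewrite subrr enorm0.
exact: (@cvgr_lt _ _ _ _ _ _ h _ ee).
Qed.

Lemma edist_le E b z : E z -> Defs.edist b E <= enorm (b - z).
Proof.
move=> Ez; apply: ge_inf; last by exists z.
by exists 0 => _ [y _ <-]; exact: enorm_ge0.
Qed.

Lemma edist_attained E b : closed E -> E !=set0 ->
  exists2 z, E z & Defs.edist b E = enorm (b - z).
Proof.
move=> cE [z0 Ez0].
have cK : compact (eball b (enorm (z0 - b)) `&` E).
  by apply: compact_closedI => //; exact: eball_compact.
have K0 : (eball b (enorm (z0 - b)) `&` E) !=set0.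
  by exists z0; split; rewrite // /eball/=.
have [|z zK zm] := @EVT_min_rV R m (fun y => enorm (b - y)) _ K0 cK.
  apply: continuous_subspaceT => y.
  apply: (@cvg_enorm_sub _ _ _ (nbhs y) _ (fun=> b) id); first exact: cvg_cst.
  exact: cvg_id.
move: zK; rewrite inE => -[zb Ez]; exists z => //.
apply/eqP; rewrite eq_le edist_le//=; apply: lb_le_inf.
  by exists (enorm (b - z)); exists z.
move=> _ [y Ey <-]; have [yb|yb] := leP (enorm (y - b)) (enorm (z0 - b)).
  by apply: zm; rewrite inE.
by rewrite (enormBC b y) (le_trans _ (ltW yb))// enormBC.
Qed.

Lemma edist_ge0 E b : 0 <= Defs.edist b E.
Proof.
have [->|/set0P E0] := eqVneq E set0; first by rewrite /Defs.edist image_set0 inf0.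
apply: lb_le_inf; last by move=> _ [y _ <-]; exact: enorm_ge0.
by case: E0 => z Ez; exists (enorm (b - z)); exists z.
Qed.

Definition trunc b E := E `&` eball b (2 * Defs.edist b E).

Lemma trunc_nonempty b E : closed E -> E !=set0 -> trunc b E !=set0.
Proof.
move=> cE E0; have [z Ez bz] := edist_attained b cE E0.
exists z; split => //; rewrite /eball/= enormBC -bz.
by rewrite mulr2n mulrDl mul1r lerDl edist_ge0.
Qed.

Lemma trunc_compact b E : closed E -> compact (trunc b E).
Proof.
move=> cE; rewrite /trunc setIC; apply: compact_closedI => //.
exact: eball_compact.
Qed.

(** [lowerE] and [upperE] say that [E_ k] converges to [E] in the sense of
    Kuratowski. *)

Section Convergence.
Variables (E_ : nat -> set 'rV[R]_m) (E : set 'rV[R]_m).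
Variables (b_ : nat -> 'rV[R]_m) (b : 'rV[R]_m).
Hypothesis cE_ : forall k, closed (E_ k).
Hypothesis E_0 : forall k, E_ k !=set0.
Hypothesis cE : closed E.
Hypothesis E0 : E !=set0.
Hypothesis convE : forall x y s, E x -> E y -> 0 <= s <= 1 -> E (s *: x + (1 - s) *: y).
Hypothesis lowerE : forall z e, E z -> 0 < e ->
  \forall k \near \oo, exists2 z', E_ k z' & enorm (z' - z) <= e.
Hypothesis upperE : forall z, ~ E z ->
  \forall z' \near z & k \near \oo, ~ E_ k z'.
Hypothesis bb : b_ k @[k --> \oo] --> b.

Let near_b e : 0 < e -> \forall k \near \oo, enorm (b_ k - b) < e.
Proof.
move=> e0; have h : enorm (b_ k - b) @[k --> \oo] --> enorm (b - b).
  by apply: cvg_enorm_sub => //; exact: cvg_cst.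
have ee : enorm (b - b) < e by rewrite subrr enorm0.
exact: (@cvgr_lt _ _ _ _ _ _ h _ ee).
Qed.

Lemma near_compact_avoid C : compact C -> (forall z, C z -> ~ E z) ->
  \forall k \near \oo, forall z, C z -> ~ E_ k z.
Proof.
move=> /compact_near_coveringP cC CE.
by apply: (cC _ \oo (fun k z => ~ E_ k z)) => z /CE /upperE.
Qed.

Lemma edist_upper e : 0 < e ->
  \forall k \near \oo, Defs.edist (b_ k) (E_ k) <= Defs.edist b E + e.
Proof.
move=> e0; have [z Ez bz] := edist_attained b cE E0.
have e20 : 0 < e / 2 by rewrite divr_gt0.
near=> k.
have [z' E'z' z'z] : exists2 z', E_ k z' & enorm (z' - z) <= e / 2.
  by near: k; exact: lowerE.
have bk : enorm (b_ k - b) < e / 2 by near: k; exact: near_b.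
apply: le_trans (edist_le (b_ k) E'z') _; rewrite bz.
have := enormB (b_ k) b z'; have := enormB b z z'; rewrite (enormBC z z'); lra.
Unshelve. all: by end_near. Qed.

(** The ball of radius slightly less than the distance is compact and misses
    [E], hence it misses [E_ k] for large [k]. *)
Lemma edist_lower e : 0 < e ->
  \forall k \near \oo, Defs.edist b E - e <= Defs.edist (b_ k) (E_ k).
Proof.
move=> e0; have e20 : 0 < e / 2 by rewrite divr_gt0.
have CE z : eball b (Defs.edist b E - e / 2) z -> ~ E z.
  by rewrite /eball/= => zb /(edist_le b); rewrite enormBC; lra.
near=> k.
have av : forall z, eball b (Defs.edist b E - e / 2) z -> ~ E_ k z.
  by near: k; exact: (near_compact_avoid (@eball_compact R m b _) CE).
have bk : enorm (b_ k - b) < e / 2 by near: k; exact: near_b.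
have [z Ez ->] := edist_attained (b_ k) (@cE_ k) (E_0 k).
have : Defs.edist b E - e / 2 < enorm (z - b).
  by rewrite ltNge; apply/negP => /av.
have := enormB z (b_ k) b; rewrite (enormBC z (b_ k)); lra.
Unshelve. all: by end_near. Qed.

Lemma cvg_edist : Defs.edist (b_ k) (E_ k) @[k --> \oo] --> Defs.edist b E.
Proof.
apply/cvgrPdist_le => e e0; near=> k.
have h1 : Defs.edist (b_ k) (E_ k) <= Defs.edist b E + e by near: k; exact: edist_upper.
have h2 : Defs.edist b E - e <= Defs.edist (b_ k) (E_ k) by near: k; exact: edist_lower.
by rewrite ler_norml; apply/andP; split; lra.
Unshelve. all: by end_near. Qed.

Lemma trunc_bounded : exists r, (forall k, trunc (b_ k) (E_ k) `<=` eball 0 r) /\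
  trunc b E `<=` eball 0 r.
Proof.
have h : enorm (b_ k - 0) + 2 * Defs.edist (b_ k) (E_ k) @[k --> \oo] -->
    enorm (b - 0) + 2 * Defs.edist b E.
  apply: cvgD; first by apply: cvg_enorm_sub => //; exact: cvg_cst.
  exact: (cvgM (cvg_cst _) cvg_edist).
have [M [_ Mh]] := cvg_seq_bounded (cvgP _ h).
have M1 := Mh (M + 1) (ltr_pwDr ltr01 (lexx M)).
have sub r' b' E' : enorm (b' - 0) + 2 * Defs.edist b' E' <= r' ->
    trunc b' E' `<=` eball 0 r'.
  move=> r'h z [_]; rewrite /eball/= => zb; apply: le_trans (enormB z b' 0) _; lra.
exists (Num.max (M + 1) (enorm (b - 0) + 2 * Defs.edist b E)); split=> [k|].
  apply: sub; rewrite le_max; apply/orP; left.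
  exact: le_trans (ler_norm _) (M1 k I).
by apply: sub; rewrite le_max lexx orbT.
Qed.

(** The points of a compact neighbourhood at which [q] exceeds its maximum over
    the limit truncation by [e] are outside this truncation; by compactness the
    [k]-th truncation avoids all of them at once. *)
Lemma support_trunc_upper q e : 0 < e -> \forall k \near \oo,
  Defs.support (trunc (b_ k) (E_ k)) q <= Defs.support (trunc b E) q + e.
Proof.
move=> e0; have [r [_ Kr]] := trunc_bounded.
pose C := eball b (2 * Defs.edist b E + 1) `&`
  [set z | Defs.support (trunc b E) q + e <= dot z q].
have cC : compact C.
  apply: compact_closedI; first exact: eball_compact.
  have -> : [set z | Defs.support (trunc b E) q + e <= dot z q] =
    (fun z => dot z q) @^-1` [set s | Defs.support (trunc b E) q + e <= s] by [].
  apply: preimage_closed; last exact: closed_ge.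
  by move=> z _; apply: (@cvg_dotl _ _ _ (nbhs z) _ id); exact: cvg_id.
have avoid : \forall k \near \oo, forall z, C z -> ~ trunc (b_ k) (E_ k) z.
  move/compact_near_coveringP : cC; apply => z [_ /= zq].
  have nK : ~ trunc b E z.
    by move=> Kz; have := le_support q Kr Kz; rewrite (dotC q); lra.
  have [Ez|nEz] := pselect (E z); last first.
    by apply: filterS (upperE nEz) => -[z' k] /= nE [].
  have g0 : 0 < (enorm (z - b) - 2 * Defs.edist b E) / 5.
    rewrite divr_gt0// subr_gt0 ltNge; apply/negP => zb.
    by apply: nK; split.
  set g := _ / 5 in g0.
  exists ([set z' | enorm (z' - z) < g], [set k | enorm (b_ k - b) < g /\
      Defs.edist (b_ k) (E_ k) <= Defs.edist b E + g]).
    split; first exact: near_enorm_lt.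
    by near=> k; split; near: k; [exact: near_b|exact: edist_upper].
  move=> [z' k] [/= z'z [bk dk]] [_]; rewrite /eball/= => z'k.
  have := enormB z z' b; have := enormB z' (b_ k) b; rewrite (enormBC z z').
  have g5 : 5 * g = enorm (z - b) - 2 * Defs.edist b E by rewrite /g; lra.
  lra.
near=> k.
have av : forall z, C z -> ~ trunc (b_ k) (E_ k) z by near: k.
have bk : enorm (b_ k - b) < 1 / 3 by near: k; apply: near_b; lra.
have dk : Defs.edist (b_ k) (E_ k) <= Defs.edist b E + 1 / 3.
  by near: k; apply: edist_upper; lra.
have [x Kx ->] := support_attained q (@trunc_compact (b_ k) _ (@cE_ k))
  (trunc_nonempty (b_ k) (@cE_ k) (E_0 k)).
rewrite leNgt; apply/negP => xq; apply: (av x) => //; split; last first.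
  by rewrite /= (dotC x) ltW.
case: Kx => _; rewrite /eball/= => xb.
by have := enormB x (b_ k) b; lra.
Unshelve. all: by end_near. Qed.

(** A maximiser [x] over the limit truncation is moved slightly towards the point
    [z] of [E] nearest to [b].  The new point [w] still belongs to [E] and lies
    in the open ball, so points of [E_ k] close to [w] belong to the [k]-th
    truncation. *)
Lemma support_trunc_lower q e : 0 < e -> \forall k \near \oo,
  Defs.support (trunc b E) q - e <= Defs.support (trunc (b_ k) (E_ k)) q.
Proof.
move=> e0; have [r [Kr_ Kr]] := trunc_bounded.
have q0 : 0 < enorm q + 1 by rewrite ltr_wpDl// enorm_ge0.
have close y x k : trunc (b_ k) (E_ k) y ->
    Defs.support (trunc b E) q - e / 2 <= dot q x ->
    enorm (y - x) <= e / 2 / (enorm q + 1) ->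
    Defs.support (trunc b E) q - e <= Defs.support (trunc (b_ k) (E_ k)) q.
  move=> Ky xq yx; apply: le_trans (le_support q (Kr_ k) Ky).
  have : dot q (x - y) <= e / 2.
    apply: le_trans (dot_le_enorm _ _) _; rewrite (enormBC x y).
    move: yx; rewrite ler_pdivlMr// => yx; apply: le_trans yx.
    by rewrite mulrC ler_wpM2l ?enorm_ge0// lerDl.
  by rewrite dotDr dotNr; lra.
pose g := e / 2 / (enorm q + 1); have g0 : 0 < g by rewrite !divr_gt0.
have [x Kx xq] := support_attained q (@trunc_compact b _ cE) (trunc_nonempty b cE E0).
have [d0|d0] := leP (Defs.edist b E) 0.
  (* Both truncations are close to the singleton of b. *)
  near=> k.
  have [y Ky] := trunc_nonempty (b_ k) (@cE_ k) (E_0 k).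
  apply: (close y x k) => //; first by rewrite xq lerBlDr lerDl ltW// divr_gt0.
  have bk : enorm (b_ k - b) < g / 4 by near: k; apply: near_b; rewrite divr_gt0.
  have dk : Defs.edist (b_ k) (E_ k) <= Defs.edist b E + g / 4.
    by near: k; apply: edist_upper; rewrite divr_gt0.
  case: Kx Ky => _; rewrite /eball/= => xb [_]; rewrite /eball/= => yb.
  have := enormB y (b_ k) x; have := enormB (b_ k) b x; rewrite (enormBC b x).
  by rewrite -/g; lra.
have [z Ez bz] := edist_attained b cE E0.
case: (Kx) => Ex; rewrite /eball/= => xb.
have D0 : 0 < enorm q * enorm (z - x) + 1 by rewrite ltr_wpDl// mulr_ge0 ?enorm_ge0.
pose s := Num.min 1 (e / 2 / (enorm q * enorm (z - x) + 1)).
have s0 : 0 < s by rewrite lt_min ltr01/= !divr_gt0.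
have s1 : s <= 1 by rewrite ge_min lexx.
pose w := s *: z + (1 - s) *: x.
have wx : w - x = s *: (z - x).
  by apply/rowP => i; rewrite !mxE; ring.
have Ew : E w by apply: convE => //; rewrite ltW.
have wb : enorm (w - b) < 2 * Defs.edist b E.
  have -> : w - b = s *: (z - b) + (1 - s) *: (x - b).
    by rewrite /w !scalerBr addrACA -opprD -scalerDl subrKC scale1r.
  apply: le_lt_trans (enormD _ _) _.
  rewrite !enormZ (ger0_norm (ltW s0)) ger0_norm ?subr_ge0// (enormBC z b) -bz.
  have : (1 - s) * enorm (x - b) <= (1 - s) * (2 * Defs.edist b E).
    by rewrite ler_wpM2l// subr_ge0.
  have : 0 < s * Defs.edist b E by rewrite mulr_gt0.
  by lra.
have wq : Defs.support (trunc b E) q - e / 2 <= dot q w.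
  have : dot q (x - w) <= e / 2.
    apply: le_trans (dot_le_enorm _ _) _.
    rewrite (enormBC x w) wx enormZ (ger0_norm (ltW s0)) mulrCA.
    apply: (@le_trans _ _ (s * (enorm q * enorm (z - x) + 1))).
      by rewrite ler_wpM2l ?(ltW s0)// lerDl.
    by rewrite -ler_pdivlMr// ge_min lexx orbT.
  by rewrite xq dotDr dotNr; lra.
pose gap := (2 * Defs.edist b E - enorm (w - b)) / 4.
have gap0 : 0 < gap by rewrite divr_gt0// subr_gt0.
have gapE : 4 * gap = 2 * Defs.edist b E - enorm (w - b) by rewrite /gap; lra.
pose h := Num.min g gap; have h0 : 0 < h by rewrite lt_min g0 gap0.
near=> k.
have [y Ey yw] : exists2 y, E_ k y & enorm (y - w) <= h by near: k; exact: lowerE.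
have bk : enorm (b_ k - b) < gap by near: k; exact: near_b.
have dk : Defs.edist b E - gap <= Defs.edist (b_ k) (E_ k).
  by near: k; exact: edist_lower.
move: yw; rewrite le_min => /andP[yg ygap].
apply: (close y w k) => //; split=> //; rewrite /eball/=.
have := enormB y w (b_ k); have := enormB w b (b_ k); rewrite (enormBC b (b_ k)).
lra.
Unshelve. all: by end_near. Qed.

Lemma cvg_steiner_trunc :
  steiner (trunc (b_ k) (E_ k)) @[k --> \oo] --> steiner (trunc b E).
Proof.
have [r [Kr_ Kr]] := trunc_bounded.
apply: (@cvg_steiner _ _ r).
- move=> k; split; [exact: trunc_compact|exact: trunc_nonempty|exact: Kr_].
- by split; [exact: trunc_compact|exact: trunc_nonempty|].
move=> q; apply/cvgrPdist_le => e e0; near=> k.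
have h1 : Defs.support (trunc (b_ k) (E_ k)) q <= Defs.support (trunc b E) q + e.
  by near: k; exact: support_trunc_upper.
have h2 : Defs.support (trunc b E) q - e <= Defs.support (trunc (b_ k) (E_ k)) q.
  by near: k; exact: support_trunc_lower.
by rewrite ler_norml; apply/andP; split; lra.
Unshelve. all: by end_near. Qed.

End Convergence.
End Truncation.

(** * Epigraphs of conjugates under pointwise convergence *)

Section PenalizedMinimum.
Context {R : realType} {n : nat}.
Implicit Types (g h : 'rV[R]_n -> R) (p q v w : 'rV[R]_n).

Definition convex_fun h := forall p q (s : R), 0 <= s <= 1 ->
  h (s *: p + (1 - s) *: q) <= s * h p + (1 - s) * h q.

Lemma enormD_sqr p q s :
  enorm (p + s *: q) ^+ 2 = enorm p ^+ 2 + 2 * s * dot p q + s ^+ 2 * enorm q ^+ 2.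
Proof. by rewrite !enorm_sqr !dotE (dotC q p); ring. Qed.

(** The hypothesis on the sphere forces a minimiser [w] of the penalised function
    over the ball into its interior.  There the convex function [g] has a
    subgradient opposite to the gradient [theta w] of the penalty: compare [w]
    with [w + s (q - w)] and let [s] tend to 0. *)
Lemma penalized_min_subgradient g (theta rho : R) :
  convex_fun g -> continuous g -> 0 < theta -> 0 <= rho ->
  (forall p, enorm p = rho -> g 0 < g p + theta / 2 * rho ^+ 2) ->
  exists w, [/\ enorm w <= rho, g w + theta / 2 * enorm w ^+ 2 <= g 0 &
    forall q, g w - theta * dot w (q - w) <= g q].
Proof.
move=> cvxg cg t0 r0 gr; pose F p := g p + theta / 2 * enorm p ^+ 2.
have Fc : continuous F.
  have ep p := @enorm_continuous R n p.
  by move=> p; exact: (cvgD (cg p) (cvgM (cvg_cst _) (cvgM (ep p) (ep p)))).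
have in0 : eball 0 rho (0 : 'rV[R]_n) by rewrite /eball/= subrr enorm0.
have [||w] := @EVT_min_rV R n F (eball 0 rho) _ (@eball_compact R n 0 rho).
- by exists 0.
- exact: continuous_subspaceT.
rewrite inE /eball/= subr0 => wr wm.
have F0 : F w <= g 0.
  have -> : g 0 = F 0 by rewrite /F enorm0 expr0n/= mulr0 addr0.
  by apply: wm; rewrite inE.
exists w; split => // q.
have {}wr : enorm w < rho.
  rewrite lt_neqAle wr andbT; apply/eqP => wr'; have := gr _ wr'.
  by move: F0; rewrite /F wr'; lra.
pose d := q - w; have d0 : 0 < enorm d + 1 by rewrite ltr_wpDl// enorm_ge0.
have D0 : 0 < theta / 2 * enorm d ^+ 2 + 1.
  by rewrite ltr_wpDl// mulr_ge0 ?sqr_ge0// divr_ge0// ltW.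
apply/ler_addgt0Pr => e e0.
pose s := Num.min 1 (Num.min ((rho - enorm w) / (enorm d + 1))
  (e / (theta / 2 * enorm d ^+ 2 + 1))).
have s0 : 0 < s by rewrite !lt_min ltr01/= !divr_gt0// subr_gt0.
have s1 : s <= 1 by rewrite ge_min lexx.
have sd : s * enorm d <= rho - enorm w.
  apply: (@le_trans _ _ (s * (enorm d + 1))).
    by rewrite ler_wpM2l ?(ltW s0)// lerDl.
  by rewrite -ler_pdivlMr// /s !ge_min lexx orbT.
have se : s * (theta / 2 * enorm d ^+ 2) <= e.
  apply: (@le_trans _ _ (s * (theta / 2 * enorm d ^+ 2 + 1))).
    by rewrite ler_wpM2l ?(ltW s0)// lerDl.
  by rewrite -ler_pdivlMr// /s !ge_min lexx !orbT.
have wsd : w + s *: d = s *: q + (1 - s) *: w.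
  by apply/rowP => i; rewrite !mxE; ring.
have : F w <= F (w + s *: d).
  apply: wm; rewrite inE /eball/= subr0; apply: le_trans (enormD _ _) _.
  by rewrite enormZ (ger0_norm (ltW s0)); lra.
rewrite /F enormD_sqr wsd => Fw.
have s01 : 0 <= s <= 1 by rewrite (ltW s0) s1.
have h1 := cvxg q w s s01.
rewrite -/d -(ler_pM2l s0).
have : s * (s * (theta / 2 * enorm d ^+ 2)) <= s * e by rewrite ler_wpM2l// ltW.
move: Fw h1; lra.
Qed.

End PenalizedMinimum.

Section ConjugateEpigraph.
Context {R : realType} {n : nat}.
Implicit Types (g h : 'rV[R]_n -> R) (p q v w : 'rV[R]_n) (z : 'rV[R]_(n + 1)).

Lemma dot_row_mx v w (a b : 'rV[R]_1) :
  dot (row_mx v a) (row_mx w b) = dot v w + a 0 0 * b 0 0.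
Proof.
rewrite /dot big_split_ord /= big_ord1; congr (_ + _).
  by apply: eq_bigr => i _; rewrite !row_mxEl.
by rewrite !row_mxEr.
Qed.

(** The epigraph of the convex conjugate of [h], written as an intersection of
    half-spaces so that closedness and convexity are visible: [z = (v, eta)]
    has product [<v, p> - eta] with [(p, -1)]. *)
Definition epi_conj h : set 'rV[R]_(n + 1) :=
  [set z | forall p, dot z (row_mx p (const_mx (-1))) <= h p].

Lemma epi_conjE h z :
  epi_conj h z <-> forall p, dot (lsubmx z) p - h p <= rsubmx z 0 0.
Proof.
have E p : dot z (row_mx p (const_mx (-1))) = dot (lsubmx z) p - rsubmx z 0 0.
  by rewrite -[z in LHS]hsubmxK dot_row_mx [const_mx _ _ _]mxE mulrN1.
by split=> hz p; have := hz p; rewrite E; lra.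
Qed.

Lemma closed_epi_conj h : closed (epi_conj h).
Proof.
have -> : epi_conj h = \bigcap_(p in [set: 'rV[R]_n])
    ((fun z => dot z (row_mx p (const_mx (-1)))) @^-1` [set s | s <= h p]).
  by apply/seteqP; split=> z hz p; [move=> _|]; exact: hz.
apply: closed_bigI => p _; apply: preimage_closed; last exact: closed_le.
by move=> z _; apply: (@cvg_dotl _ _ _ (nbhs z) _ id); exact: cvg_id.
Qed.

Lemma convex_epi_conj h x y (s : R) : epi_conj h x -> epi_conj h y ->
  0 <= s <= 1 -> epi_conj h (s *: x + (1 - s) *: y).
Proof.
move=> hx hy /andP[s0 s1] p; rewrite dotDl !dotZl.
have : s * dot x (row_mx p (const_mx (-1))) <= s * h p by rewrite ler_wpM2l.
have : (1 - s) * dot y (row_mx p (const_mx (-1))) <= (1 - s) * h p.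
  by rewrite ler_wpM2l// subr_ge0.
by lra.
Qed.

(** Lipschitz continuity bounds the minimisers of [h + |p|^2 / 2], hence [h] has
    an affine minorant. *)
Lemma epi_conj_nonempty h (C : R) : convex_fun h ->
  (forall p q, `|h p - h q| <= C * enorm (p - q)) -> epi_conj h !=set0.
Proof.
move=> cvxh hC; have ch := lipschitz_continuous hC.
pose rho := 2 * `|C| + 1.
have r0 : 0 <= rho by rewrite /rho addr_ge0// mulr_ge0.
have [p pr|w [_ _ hw]] := @penalized_min_subgradient R n h 1 rho cvxh ch ltr01 r0.
  have := hC 0 p; rewrite sub0r enormN pr ler_norml => /andP[_].
  have : C * rho <= `|C| * rho by rewrite ler_wpM2r// ler_norm.
  by have := normr_ge0 C; rewrite /rho; nra.
exists (row_mx (- w) (const_mx (- h w - dot w w))) => p.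
have := hw p; rewrite dot_row_mx !mxE mul1r dotDr !dotNr dotNl; lra.
Qed.

Section Convergence.
Variables (h_ : nat -> 'rV[R]_n -> R) (h : 'rV[R]_n -> R) (C : R).
Hypothesis cvxh_ : forall k, convex_fun (h_ k).
Hypothesis h_C : forall k p q, `|h_ k p - h_ k q| <= C * enorm (p - q).
Hypothesis hC : forall p q, `|h p - h q| <= C * enorm (p - q).
Hypothesis hh : forall p, h_ k p @[k --> \oo] --> h p.

(** Pointwise convergence of equi-Lipschitz functions is uniform on compact
    sets. *)
Lemma near_compact_unif (K : set 'rV[R]_n) (e : R) : compact K -> 0 < e ->
  \forall k \near \oo, forall p, K p -> `|h_ k p - h p| <= e.
Proof.
move=> /compact_near_coveringP cK e0.
apply: (cK _ \oo (fun k p => `|h_ k p - h p| <= e)) => p _.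
have d0 : 0 < e / 3 / (`|C| + 1) by rewrite !divr_gt0// ltr_wpDl.
exists ([set q | enorm (q - p) < e / 3 / (`|C| + 1)],
        [set k | `|h_ k p - h p| <= e / 3]).
  split; first exact: near_enorm_lt.
  have e30 : 0 < e / 3 by rewrite divr_gt0.
  near=> k; rewrite /= distrC; near: k.
  by have /cvgrPdist_le := @hh p; exact.
move=> [q k] [/= qp hk].
have Cq : C * enorm (q - p) <= e / 3.
  move: qp; rewrite ltr_pdivlMr// mulrC => /ltW; apply: le_trans.
  by rewrite ler_wpM2r ?enorm_ge0//; have := ler_norm C; lra.
have := h_C k q p; have := hC q p.
have -> : h_ k q - h q = (h_ k q - h_ k p) + (h_ k p - h p) - (h q - h p) by ring.
have := ler_normB (h_ k q - h_ k p + (h_ k p - h p)) (h q - h p).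
have := ler_normD (h_ k q - h_ k p) (h_ k p - h p).
lra.
Unshelve. all: by end_near. Qed.

Lemma epi_conj_upper z : ~ epi_conj h z ->
  \forall z' \near z & k \near \oo, ~ epi_conj (h_ k) z'.
Proof.
move=> /existsNP[p /negP]; rewrite -ltNge => hp.
set P := row_mx p _ in hp; pose mid := (h p + dot z P) / 2.
exists ([set z' | mid < dot z' P], [set k | h_ k p < mid]).
  split.
    have h1 : dot z' P @[z' --> z] --> dot z P.
      by apply: (@cvg_dotl _ _ _ (nbhs z) _ id); exact: cvg_id.
    have h2 : mid < dot z P by rewrite /mid; lra.
    exact: (@cvgr_gt _ _ _ _ _ _ h1 _ h2).
  have h2 : h p < mid by rewrite /mid; lra.
  exact: (@cvgr_lt _ _ _ _ _ _ (@hh p) _ h2).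
by move=> [z' k] [/= z'P kp] /(_ p); rewrite -/P; lra.
Unshelve. all: by end_near. Qed.

(** If [z = (v, eta)] is in the epigraph, then [g p := h_ k p - <v, p> + eta + dl]
    is nonnegative on a large ball for large [k].  The penalised minimum of
    [g] yields a linear minorant of [g] of small slope [- theta w], so that
    [(v - theta w, eta + dl)] is in the [k]-th epigraph. *)
Lemma epi_conj_lower z (e : R) : epi_conj h z -> 0 < e ->
  \forall k \near \oo, exists2 z', epi_conj (h_ k) z' & enorm (z' - z) <= e.
Proof.
move=> /epi_conjE hz e0; set v := lsubmx z in hz; set eta := rsubmx z 0 0 in hz.
pose dl := e / 2; have dl0 : 0 < dl by rewrite divr_gt0.
(* A bounds g at 0; theta makes the slope at most dl, because
   (theta |w|)^2 <= 2 theta A; rho puts the sphere above the level A. *)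
pose A := h 0 + eta + 2 * dl.
have A0 : 0 < A by have := hz 0; rewrite /A dotC dot0l; lra.
pose theta := dl ^+ 2 / (2 * A).
have t0 : 0 < theta by rewrite !divr_gt0 ?exprn_gt0// mulr_gt0.
pose rho := 2 * A / theta + 1.
have r1 : 2 * A < theta / 2 * rho ^+ 2.
  have : 0 <= 2 * A / theta by rewrite ltW// divr_gt0// mulr_gt0.
  have : theta * (2 * A / theta) = 2 * A by rewrite mulrC divfK// gt_eqF.
  rewrite /rho; set x := _ / theta => tx x0.
  have : 0 <= theta * x ^+ 2 by rewrite mulr_ge0 ?sqr_ge0// ltW.
  by lra.
have r0 : 0 <= rho by rewrite /rho addr_ge0// ltW// divr_gt0// mulr_gt0.
near=> k.
have un : forall p, eball 0 rho p -> `|h_ k p - h p| <= dl.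
  by near: k; exact: (near_compact_unif (@eball_compact R n 0 rho) dl0).
pose g p := h_ k p + (eta + dl - dot v p).
have cvxg : convex_fun g.
  move=> p q s s01; have := cvxh_ k p q s01; rewrite /g dotDr !dotZr; lra.
have cg : continuous g.
  apply: (@lipschitz_continuous _ _ (C + enorm v)) => p q; rewrite /g.
  have -> : h_ k p + (eta + dl - dot v p) - (h_ k q + (eta + dl - dot v q)) =
    (h_ k p - h_ k q) - dot v (p - q) by rewrite dotDr dotNr; ring.
  apply: le_trans (ler_normB _ _) _; rewrite mulrDl lerD//.
  exact: dot_abs_le_enorm.
have gpos p : enorm p <= rho -> 0 <= g p.
  move=> pr; have := hz p; have := un p; rewrite /eball/= subr0 => /(_ pr).
  by rewrite ler_norml /g => /andP[]; lra.
have g0 : g 0 <= A.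
  have := un 0; rewrite /eball/= subr0 enorm0 => /(_ r0); rewrite ler_norml.
  by rewrite /g /A dotC dot0l => /andP[]; lra.
have [p pr|w [wr w0 hw]] := penalized_min_subgradient cvxg cg t0 r0.
  by have := gpos p; rewrite pr lexx => /(_ isT); lra.
exists (row_mx (v - theta *: w) (const_mx (eta + dl))).
  apply/epi_conjE => p; rewrite row_mxKl row_mxKr mxE dotDl dotNl dotZl.
  have := hw p; have := gpos _ wr; have : 0 <= theta * dot w w.
    by rewrite mulr_ge0 ?dot_ge0// ltW.
  rewrite dotDr dotNr {3}/g; lra.
have -> : row_mx (v - theta *: w) (const_mx (eta + dl)) - z =
    row_mx (- theta *: w) (const_mx dl).
  rewrite -[z in LHS]hsubmxK opp_row_mx add_row_mx; congr row_mx.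
    by rewrite addrAC subrr add0r scaleNr.
  by apply/rowP => i; rewrite !mxE (ord1 i) /eta mxE; ring.
have wA : (theta * enorm w) ^+ 2 <= dl ^+ 2.
  have : theta * (theta / 2 * enorm w ^+ 2) <= theta * A.
    by rewrite ler_wpM2l ?(ltW t0)//; have := gpos _ wr; lra.
  have : theta * (2 * A) = dl ^+ 2 by rewrite divfK// gt_eqF// mulr_gt0.
  by rewrite exprMn; lra.
rewrite -(@ler_pXn2r _ 2)// ?nnegrE ?enorm_ge0// ?(ltW e0)//.
rewrite enorm_sqr dot_row_mx -enorm_sqr enormZ normrN (gtr0_norm t0) !mxE.
have : e ^+ 2 = 4 * dl ^+ 2 by rewrite /dl; field.
by have := sqr_ge0 dl; lra.
Unshelve. all: by end_near. Qed.

End Convergence.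
End ConjugateEpigraph.

(** * Continuous convergence and the canonical representation *)

Section ContinuousConvergence.

Lemma compact_range_lim (X : topologicalType) (u : nat -> X) (z : X) :
  u k @[k --> \oo] --> z -> compact (range u `|` [set z]).
Proof.
move=> uz; apply/compact_near_coveringP => I F P FF cP.
have single x : (range u `|` [set z]) x -> \forall i \near F, P i x.
  move=> /cP[[U V] [/= Ux FV] UV]; apply: filterS FV => i Vi.
  by apply: (UV (x, i)); split => //=; exact: nbhs_singleton Ux.
have head N : \forall i \near F, forall k, (k < N)%N -> P i (u k).
  elim: N => [|N IH]; first by apply: nearW.
  have uN : \forall i \near F, P i (u N) by apply: single; left; exists N.
  near=> i => k; rewrite ltnS leq_eqVlt => /predU1P[->|]; first by near: i.
  by move: k; near: i.
have [[U V] [/= Uz FV] UV] := cP z (or_intror erefl).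
have [N _ uU] := uz _ Uz.
near=> i => x [[k _ <-]|->].
- have [kN|Nk] := ltnP k N.
    by move: k kN; near: i; exact: head.
  by apply: (UV (u k, i)); split => /=; [exact: uU|near: i].
- by near: i; apply: single; right.
Unshelve. all: by end_near. Qed.

Lemma cvg_seq_fst (A B : topologicalType) (u : nat -> A * B) (w : A * B) :
  u k @[k --> \oo] --> w -> (u k).1 @[k --> \oo] --> w.1.
Proof.
move=> uw P Pw; apply: (uw (fst @^-1` P)).
by exists (P, setT) => [|[p q] [/= Pp _]//]; split; [|exact: filter_nbhsT].
Qed.

Lemma cvg_seq_snd (A B : topologicalType) (u : nat -> A * B) (w : A * B) :
  u k @[k --> \oo] --> w -> (u k).2 @[k --> \oo] --> w.2.
Proof.
move=> uw P Pw; apply: (uw (snd @^-1` P)).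
by exists (setT, P) => [|[p q] [/= _ Pq]//]; split; [exact: filter_nbhsT|].
Qed.

Context {R : realType} {U V : pseudoMetricType R}.
Implicit Types (D : set U) (g : U -> V).

Lemma locally_uniform_ball D (g_ : nat -> U -> V) g A (e : R) :
  cvg_locally_uniformly D g_ g -> compact A -> A `<=` D -> 0 < e ->
  \forall i \near \oo, forall y, A y -> ball (g y) e (g_ i y).
Proof.
move=> /fam_cvgP gg cA AD e0.
apply: (gg A (conj AD cA) [set h | forall y, A y -> ball (g y) e (h y)]).
apply/uniform_nbhs; exists [set xy | ball xy.1 e xy.2]; split => //.
exact: entourage_ball (PosNum e0).
Qed.

(** Along [y k --> z], the points [y k] and [z] form a compact set, on which
    the uniform estimates for [g_ i] at a large but fixed [i] and the
    continuity of this one [g_ i] give the limit. *)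
Lemma locally_uniform_diag D (g_ : nat -> U -> V) g
    (i_ : nat -> nat) (y : nat -> U) (z : U) :
  (forall i, {within D, continuous (g_ i)}) ->
  cvg_locally_uniformly D g_ g ->
  i_ k @[k --> \oo] --> \oo -> (forall k, D (y k)) -> D z ->
  y k @[k --> \oo] --> z -> g_ (i_ k) (y k) @[k --> \oo] --> g z.
Proof.
move=> cg gg ioo yD zD yz; apply/cvg_ballP => e e0.
have AD : (range y `|` [set z]) `<=` D by move=> x [[k _ <-]|->].
have e40 : 0 < e / 4 by rewrite divr_gt0.
have un := locally_uniform_ball gg (compact_range_lim yz) AD e40.
have [N _ unN] := un.
have gNz : g_ N (y k) @[k --> \oo] --> g_ N z.
  move=> B /= Bz; have /subspace_continuousP/(_ z zD) := cg N => /(_ _ Bz) W.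
  by have [N' _ hN'] := yz _ W; exists N' => // k /hN'; apply; exact: yD.
have ik : \forall k \near \oo, ball (g (y k)) (e / 4) (g_ (i_ k) (y k)).
  by have [N' _ hN'] := ioo _ un; exists N' => // k /hN'; apply; left; exists k.
have gk : \forall k \near \oo, ball (g_ N z) (e / 4) (g_ N (y k)).
  exact: (cvg_ball gNz e40).
near=> k.
have -> : e = e / 4 + e / 4 + e / 4 + e / 4 by lra.
apply: (@ball_triangle _ _ (g (y k))); last first.
  by near: k; exact: ik.
apply: (@ball_triangle _ _ (g_ N (y k))); last first.
  by apply: ball_sym; apply: (unN N (leqnn N)); left; exists k.
apply: (@ball_triangle _ _ (g_ N z)); first by apply: (unN N (leqnn N)); right.
by near: k; exact: gk.
Unshelve. all: by end_near. Qed.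

(** Convergence along all sequences [g_ (i_ k) (y k)] gives, the neighbourhoods
    having countable bases, an estimate of [g_ i y - g z] for all large [i] and
    all [y] near [z].  Letting [i] tend to infinity with [y] fixed, it also
    bounds [g y - g z], and compactness makes the estimate uniform. *)
Lemma locally_uniformP D (g_ : nat -> U -> V) g :
  (forall (i_ : nat -> nat) (y : nat -> U) (z : U),
    i_ k @[k --> \oo] --> \oo -> (forall k, D (y k)) -> D z ->
    y k @[k --> \oo] --> z -> g_ (i_ k) (y k) @[k --> \oo] --> g z) ->
  cvg_locally_uniformly D g_ g.
Proof.
move=> H.
have joint z (e : R) : D z -> 0 < e -> exists (N : nat) (d : {posnum R}),
    forall i y, (N <= i)%N -> D y -> ball z d%:num y -> ball (g z) e (g_ i y).
  move=> Dz e0; apply: contrapT => nH.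
  have W k : exists iy : nat * U, [/\ (k <= iy.1)%N, D iy.2,
      ball z k.+1%:R^-1 iy.2 & ~ ball (g z) e (g_ iy.1 iy.2)].
    apply: contrapT => nW; apply: nH; exists k.
    have k0 : 0 < k.+1%:R^-1 :> R by [].
    exists (PosNum k0) => i y ki Dy zy; apply: contrapT => ny.
    by apply: nW; exists (i, y).
  have [iy iyP] := choice W.
  have ioo : (iy k).1 @[k --> \oo] --> \oo.
    move=> B [N _ NB]; exists N => // k /= Nk; apply: NB => /=.
    by have [kk _ _ _] := iyP k; exact: leq_trans Nk kk.
  have yz : (iy k).2 @[k --> \oo] --> z.
    apply/cvg_ballP => d d0; have [N _ Nd] := near_infty_natSinv_lt (PosNum d0).
    exists N => // k /= Nk; have [_ _ zk _] := iyP k.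
    by apply: le_ball zk; apply: ltW; exact: Nd.
  have yD k : D (iy k).2 by have [] := iyP k.
  have [N _ hN] := cvg_ball (H _ _ _ ioo yD Dz yz) e0.
  by have [_ _ _] := iyP N; apply; exact: hN (leqnn N).
apply/fam_cvgP => A [AD /compact_near_coveringP cA].
move=> P /uniform_nbhs[E [entE EP]].
move: entE; rewrite -entourage_ballE => -[e /= e0 eE].
suff : \forall i \near \oo, forall y, A y -> ball (g y) e (g_ i y).
  apply: filterS => i h; apply: EP => y Ay; apply: eE; exact: h.
suff : \forall i \near \oo, A `<=` [set y | A y -> ball (g y) e (g_ i y)].
  by apply: filterS => i h y Ay; exact: h.
apply: (cA _ \oo (fun i y => A y -> ball (g y) e (g_ i y))) => z Az.
have e30 : 0 < e / 3 by rewrite divr_gt0.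
have [N [d h]] := joint z (e / 3) (AD _ Az) e30.
exists (ball z d%:num, [set i | (N <= i)%N]).
  by split; [exact: nbhsx_ballx|exists N].
move=> [y i] [/= zy Ni] Ay; have Dy := AD _ Ay.
have [N' _ gy] := cvg_ball (H id (fun=> y) y cvg_id (fun=> Dy) Dy (cvg_cst y)) e30.
have -> : e = e / 3 + e / 3 + e / 3 by lra.
apply: (@ball_triangle _ _ (g z)); last exact: h.
apply: (@ball_triangle _ _ (g_ (maxn N N') y)).
  by apply: gy; rewrite /= leq_maxr.
by apply: ball_sym; apply: h => //; exact: leq_maxl.
Qed.

End ContinuousConvergence.

Section CanonicalRepresentation.
Context {R : realType} {n : nat}.

Lemma epiLE (H : R -> 'rV[R]_n -> 'rV[R]_n -> R) t x :
  epiL H t x = epi_conj (H t x).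
Proof.
apply/seteqP; split=> z; rewrite /epiL /lagrangian /=.
  move=> /ereal_supP h; apply/epi_conjE => p.
  by have := h _ (ex_intro2 _ _ p I erefl); rewrite lee_fin.
move=> /epi_conjE h; apply/ereal_supP => _ [p _ <-].
by rewrite lee_fin.
Qed.

Variables (T : R) (H_ : nat -> R -> 'rV[R]_n -> 'rV[R]_n -> R)
    (c_ : nat -> R -> R) (lam_ : nat -> R -> 'rV[R]_n -> R)
    (H : R -> 'rV[R]_n -> 'rV[R]_n -> R)
    (c : R -> R) (lam : R -> 'rV[R]_n -> R).
Hypothesis adm_ : forall i, boundedly_admissible T (H_ i) (c_ i) (lam_ i).
Hypothesis adm : boundedly_admissible T H c lam.
Hypothesis contH_ : forall i,
      {within `[0, T] `*` [set: 'rV[R]_n] `*` [set: 'rV[R]_n],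
        continuous (fun z : R * 'rV[R]_n * 'rV[R]_n => H_ i z.1.1 z.1.2 z.2)}.
Hypothesis contlam_ : forall i,
      {within `[0, T] `*` [set: 'rV[R]_n],
        continuous (fun z : R * 'rV[R]_n => lam_ i z.1 z.2)}.
Hypothesis contc_ : forall i, {within `[0, T], continuous (c_ i)}.
Hypothesis cvgH : cvg_locally_uniformly
      (`[0, T] `*` [set: 'rV[R]_n] `*` [set: 'rV[R]_n])
      (fun i (z : R * 'rV[R]_n * 'rV[R]_n) => H_ i z.1.1 z.1.2 z.2)
      (fun z : R * 'rV[R]_n * 'rV[R]_n => H z.1.1 z.1.2 z.2).
Hypothesis cvglam : cvg_locally_uniformly
      (`[0, T] `*` [set: 'rV[R]_n])
      (fun i (z : R * 'rV[R]_n) => lam_ i z.1 z.2)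
      (fun z : R * 'rV[R]_n => lam z.1 z.2).
Hypothesis cvgc : cvg_locally_uniformly `[0, T] c_ c.

Lemma cvg_canonical_e (i_ : nat -> nat) (t_ : nat -> R) (x_ : nat -> 'rV[R]_n)
    (a_ : nat -> 'rV[R]_(n + 1)) t x a :
  i_ k @[k --> \oo] --> \oo -> (forall k, t_ k \in `[0, T]) -> t \in `[0, T] ->
  t_ k @[k --> \oo] --> t -> x_ k @[k --> \oo] --> x -> a_ k @[k --> \oo] --> a ->
  canonical_e (H_ (i_ k)) (c_ (i_ k)) (lam_ (i_ k)) (t_ k) (x_ k) (a_ k)
    @[k --> \oo] --> canonical_e H c lam t x a.
Proof.
move=> ioo tT_ tT tt xx aa.
have hh p : H_ (i_ k) (t_ k) (x_ k) p @[k --> \oo] --> H t x p.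
  apply: (@locally_uniform_diag R _ _ _ _ _ i_ (fun k => (t_ k, x_ k, p))
    (t, x, p) contH_ cvgH ioo).
  - by move=> k; split=> //; split=> //=; exact: tT_.
  - by split.
  - exact: (cvg_pair (cvg_pair tt xx) (cvg_cst p)).
have ll : lam_ (i_ k) (t_ k) (x_ k) @[k --> \oo] --> lam t x.
  apply: (@locally_uniform_diag R _ _ _ _ _ i_ (fun k => (t_ k, x_ k))
    (t, x) contlam_ cvglam ioo).
  - by move=> k; split=> //=; exact: tT_.
  - by split.
  - exact: (cvg_pair tt xx).
have cc : c_ (i_ k) (t_ k) @[k --> \oo] --> c t.
  by apply: (@locally_uniform_diag R _ _ _ _ _ i_ t_ t contc_ cvgc ioo).
have xn : enorm (x_ k) @[k --> \oo] --> enorm x.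
  by apply: continuous_cvg xx; exact: enorm_continuous.
have lip : c_ (i_ k) (t_ k) * (1 + enorm (x_ k)) @[k --> \oo] --> c t * (1 + enorm x).
  exact: (cvgM cc (cvgD (cvg_cst _) xn)).
have rr : Defs.radius (H_ (i_ k)) (c_ (i_ k)) (lam_ (i_ k)) (t_ k) (x_ k)
    @[k --> \oo] --> Defs.radius H c lam t x.
  rewrite /Defs.radius; apply: cvgD; last exact: cvg_cst.
  apply: cvgD lip; apply: cvgD; first exact: cvg_norm ll.
  exact: cvg_norm (@hh 0).
have bb := cvgZ rr aa.
have [M [_ /(_ (M + 1) (ltr_pwDr ltr01 (lexx M))) hM]] := cvg_seq_bounded (cvgP _ lip).
pose C := Num.max (M + 1) (c t * (1 + enorm x)).
have h_C k p q : `|H_ (i_ k) (t_ k) (x_ k) p - H_ (i_ k) (t_ k) (x_ k) q|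
    <= C * enorm (p - q).
  apply: le_trans (H_lipschitz (adm_ (i_ k)) _ _ _ (tT_ k)) _.
  rewrite ler_wpM2r ?enorm_ge0// le_max; apply/orP; left.
  exact: le_trans (ler_norm _) (hM k I).
have hC p q : `|H t x p - H t x q| <= C * enorm (p - q).
  apply: le_trans (H_lipschitz adm _ _ _ tT) _.
  by rewrite ler_wpM2r ?enorm_ge0// le_max lexx orbT.
have cvxh_ k : convex_fun (H_ (i_ k) (t_ k) (x_ k)).
  by move=> p q s; exact: (H_convex (adm_ (i_ k))).
have cvxh : convex_fun (H t x) by move=> p q s; exact: (H_convex adm).
rewrite /canonical_e epiLE.
under eq_fun do rewrite epiLE.
apply: cvg_steiner_trunc.
- by move=> k; exact: closed_epi_conj.
- by move=> k; exact: epi_conj_nonempty (cvxh_ k) (h_C k).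
- exact: closed_epi_conj.
- exact: epi_conj_nonempty cvxh hC.
- by move=> *; exact: convex_epi_conj.
- by move=> z e; exact: epi_conj_lower cvxh_ h_C hC hh z e.
- by move=> z; exact: epi_conj_upper hh z.
- exact: bb.
Qed.

Lemma canonical_locally_uniform (V : pseudoMetricType R) (phi : 'rV[R]_(n + 1) -> V) :
  continuous phi -> cvg_locally_uniformly
    (`[0, T] `*` [set: 'rV[R]_n] `*` eball 0 1)
    (fun i (z : R * 'rV[R]_n * 'rV[R]_(n + 1)) =>
      phi (canonical_e (H_ i) (c_ i) (lam_ i) z.1.1 z.1.2 z.2))
    (fun z : R * 'rV[R]_n * 'rV[R]_(n + 1) =>
      phi (canonical_e H c lam z.1.1 z.1.2 z.2)).
Proof.
move=> cphi; apply: (@locally_uniformP R) => i_ y z ioo yD zD yz.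
apply: continuous_cvg; first exact: cphi.
have y1 := cvg_seq_fst yz.
apply: cvg_canonical_e => //.
- by move=> k; have [[]] := yD k.
- by case: zD => [[]].
- exact: (cvg_seq_fst y1).
- exact: (cvg_seq_snd y1).
- exact: (cvg_seq_snd yz).
Qed.

End CanonicalRepresentation.

Unset Implicit Arguments.

Theorem theorem3p10 (R : realType) (n : nat) (T : R)
    (H_ : nat -> R -> 'rV[R]_n -> 'rV[R]_n -> R)
    (c_ : nat -> R -> R) (lam_ : nat -> R -> 'rV[R]_n -> R)
    (H : R -> 'rV[R]_n -> 'rV[R]_n -> R)
    (c : R -> R) (lam : R -> 'rV[R]_n -> R)
    (adm_ : forall i, boundedly_admissible T (H_ i) (c_ i) (lam_ i))
    (adm : boundedly_admissible T H c lam)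
    (contH_ : forall i,
      {within `[0, T] `*` [set: 'rV[R]_n] `*` [set: 'rV[R]_n],
        continuous (fun z : R * 'rV[R]_n * 'rV[R]_n => H_ i z.1.1 z.1.2 z.2)})
    (contlam_ : forall i,
      {within `[0, T] `*` [set: 'rV[R]_n],
        continuous (fun z : R * 'rV[R]_n => lam_ i z.1 z.2)})
    (contc_ : forall i, {within `[0, T], continuous (c_ i)})
    (cvgH : cvg_locally_uniformly
      (`[0, T] `*` [set: 'rV[R]_n] `*` [set: 'rV[R]_n])
      (fun i (z : R * 'rV[R]_n * 'rV[R]_n) => H_ i z.1.1 z.1.2 z.2)
      (fun z : R * 'rV[R]_n * 'rV[R]_n => H z.1.1 z.1.2 z.2))
    (cvglam : cvg_locally_uniformly
      (`[0, T] `*` [set: 'rV[R]_n])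
      (fun i (z : R * 'rV[R]_n) => lam_ i z.1 z.2)
      (fun z : R * 'rV[R]_n => lam z.1 z.2))
    (cvgc : cvg_locally_uniformly `[0, T] c_ c) :
  cvg_locally_uniformly
    (`[0, T] `*` [set: 'rV[R]_n] `*` eball 0 1)
    (fun i (z : R * 'rV[R]_n * 'rV[R]_(n + 1)) =>
      canonical_f (H_ i) (c_ i) (lam_ i) z.1.1 z.1.2 z.2)
    (fun z : R * 'rV[R]_n * 'rV[R]_(n + 1) =>
      canonical_f H c lam z.1.1 z.1.2 z.2)
  /\
  cvg_locally_uniformly
    (`[0, T] `*` [set: 'rV[R]_n] `*` eball 0 1)
    (fun i (z : R * 'rV[R]_n * 'rV[R]_(n + 1)) =>
      canonical_l (H_ i) (c_ i) (lam_ i) z.1.1 z.1.2 z.2)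
    (fun z : R * 'rV[R]_n * 'rV[R]_(n + 1) =>
      canonical_l H c lam z.1.1 z.1.2 z.2).
Proof.
have cunif := canonical_locally_uniform adm_ adm contH_ contlam_ contc_ cvgH
  cvglam cvgc.
have coord (j : 'I_(n + 1)) : continuous (fun z : 'rV[R]_(n + 1) => z 0 j).
  move=> z; exact: coord_continuous.
split.
- apply: (cunif _ (@lsubmx R 1 n 1)) => z.
  apply: (@cvg_rowP R n _ (nbhs z)) => j; rewrite mxE.
  by under eq_fun do rewrite mxE; exact: coord.
- apply: (cunif _ (fun z => rsubmx z 0 0)).
  rewrite (_ : (fun z => _) = fun z : 'rV[R]_(n + 1) => z 0 (rshift n 0)).
    exact: coord.
  by apply/funext => z; rewrite mxE.
Qed.
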